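(* Let $\psi(x)=\sum_{n\le x}\Lambda(n)$, where $\Lambda$ is the von Mangoldt function. Fix $\epsilon>0$ and suppose there are absolute constants $A,B>1$ such that for every even positive integer $k$, $$\int_{1}^{X} (\psi(x+\delta x) - \psi(x) - \delta x)^k\, dx = \frac{\Gamma(k+1)}{\Gamma(\frac{k}{2}+2) 2^{k/2}} X^{k/2 + 1} \delta^{k/2} \Bigl(\log{\frac{1}{\delta}}\Bigr)^{k/2} + O\bigl(A^{B^k} X^{k/2+1} \delta^{k/2} (\log X)^{k/2-1}\bigr)$$ uniformly for $X^{-1+\epsilon} \leq \delta \leq X^{-\epsilon}$ (the implied constant being independent of $k$, $X$, $\delta$). Then for any $\lambda > 0$, $$\int_{1}^{X} |\psi(x+\delta x) - \psi(x) - \delta x|^{\lambda}\, dx = \frac{\Gamma (\lambda+1)}{\Gamma(\frac{\lambda}{2} + 2) 2^{\lambda/2}} X^{\lambda/2+1} \delta^{\lambda/2} \Bigl(\log\frac{1}{\delta}\Bigr)^{\lambda/2} + O_{\lambda}\Bigl(\frac{X^{\lambda/2+1} \delta^{\lambda/2} (\log\frac{1}{\delta})^{\lambda/2}}{\log_{4}{X}} \Bigr)$$ uniformly for $X^{-1+\epsilon} \leq \delta \leq X^{-\epsilon}$ (as $X\to\infty$).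
   Context: $\Gamma$ is the gamma function. $\log_n x$ denotes the $n$-times iterated logarithm: $\log_1 x=\log x$, $\log_{i+1}x=\log(\log_i x)$. The implied constant in $O_\lambda$ may depend on $\lambda$ (and on the fixed $\epsilon, A, B$). *)

(* Defs.v *)
From HB Require Import structures.
From mathcomp Require Import all_boot all_order all_algebra.
From mathcomp Require Import all_classical all_reals all_analysis.

Set Implicit Arguments.
Unset Strict Implicit.
Unset Printing Implicit Defensive.

Import Order.TTheory GRing.Theory Num.Theory.
Import numFieldNormedType.Exports.

Local Open Scope classical_set_scope.
Local Open Scope ring_scope.

(* [primes n] is the duplicate-free list of the prime divisors of [n], so it is
   a singleton [:: p] exactly when n = p ^ m for some m > 0. *)
Definition vonMangoldt (R : realType) (n : nat) : R :=
  if primes n is [:: p] then ln p%:R else 0.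

Definition chebyshev_psi (R : realType) (x : R) : R :=
  \sum_(1 <= n < (Num.truncn x).+1) vonMangoldt R n.

(* For s <= 0 the integral diverges and this is 0 (convention of Rintegral). *)
Definition Gamma (R : realType) (s : R) : R :=
  \int[@lebesgue_measure R]_(t in `]0, +oo[) (t `^ (s - 1) * expR (- t)).

Definition iter_log (R : realType) (n : nat) (x : R) : R := iter n (@ln R) x.

Definition psi_gap (R : realType) (delta x : R) : R :=
  chebyshev_psi (x + delta * x) - chebyshev_psi x - delta * x.

(* Main.v *)
Require Import Defs.
From HB Require Import structures.
From mathcomp Require Import all_boot all_order all_algebra.
From mathcomp Require Import all_classical all_reals all_analysis.
From mathcomp Require Import measurable_realfun ring lra.
Import Order.TTheory GRing.Theory Num.Theory.
Import numFieldNormedType.Exports.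
Local Open Scope classical_set_scope.
Local Open Scope ring_scope.

(* Normalise t = psi_gap^2 / (X delta log(1/delta)), with x uniform on [1, X].
   The hypothesis says that the moments E t^k, 1 <= k <= K, are close to those
   of a fixed law, namely that of U N^2 with U uniform on [0, 1] and N standard
   Gaussian, where K can be taken of order log_3 X; the theorem asks for the
   non-integral moment E t^s, s = lam / 2.  Let m = floor s.  Up to a constant
   factor, t^s is the integral of (cos (sqrt(u t)) - Taylor polynomial of
   degree m in u t) / u^(s+1) over u > 0.  Cutting the integral at tau and
   replacing the cosine by a longer Taylor polynomial gives a polynomial in t
   whose distance to c t^s is, for all t >= 0, at most a constant times
   tau^(m-s) t^m plus the next Taylor term.  Integrating this one inequality
   against both laws compares their moments of order s using only moments of
   integral order at most K, with an error O(tau^(m-s)), tau of order K; this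
   is far below 1 / log K, hence below a multiple of 1 / log_4 X.  That the
   limiting moments come from a positive measure rests on Legendre's
   duplication formula. *)

Set Implicit Arguments.
Unset Strict Implicit.
Unset Printing Implicit Defensive.

(** * Generalised polynomials *)

(** Each pair is a coefficient with a real exponent. Kept as data, the terms can be differentiated,
    divided by exponents or paired with a functional by acting on the list. *)
Definition powsum (R : realType) (s : seq (R * R)) (t : R) : R :=
  \sum_(p <- s) p.1 * t `^ p.2.

Lemma is_derive_powsum (R : realType) (s : seq (R * R)) (t : R) : 0 < t ->
  is_derive t 1 (powsum s) (\sum_(p <- s) p.1 * p.2 * t `^ (p.2 - 1)).
Proof.
move=> t0; elim: s => [|p s IH].
  rewrite big_nil.
  have -> : @powsum R [::] = cst 0 by apply/funext => x; rewrite /powsum big_nil.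
  exact: is_derive_cst.
rewrite big_cons.
have -> : powsum (p :: s) = (p.1 *: (@powR R ^~ p.2)) + powsum s.
  by apply/funext => x; rewrite /powsum big_cons.
rewrite -mulrA.
apply: is_deriveD.
exact: is_deriveZ (is_derive1_powR _ t0).
Qed.

(** The list in the hypothesis represents [t] times the derivative, which has the sign of the
    derivative and keeps the exponents of [s]. *)
Lemma powsum_nondecreasing (R : realType) (s : seq (R * R)) :
  (forall t, 0 < t -> 0 <= powsum [seq (p.1 * p.2, p.2) | p <- s] t) ->
  forall x y, 0 < x -> x <= y -> powsum s x <= powsum s y.
Proof.
move=> h x y x0 xy.
have d t : 0 < t -> derivable (powsum s) t 1.
  by move=> t0; case: (is_derive_powsum s t0).
apply: (@ger0_derive1_ndecr R (powsum s) x y) => //.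
- by move=> t; rewrite in_itv/= => /andP[xt _]; apply: d; exact: lt_trans xt.
- move=> t; rewrite in_itv/= => /andP[xt _].
  have t0 : 0 < t by exact: lt_trans xt.
  rewrite derive1E; have [_ ->] := is_derive_powsum s t0.
  have := h _ t0; rewrite /powsum big_map /=.
  rewrite -(pmulr_rge0 (\sum_(p <- s) p.1 * p.2 * t `^ (p.2 - 1)) t0).
  congr (0 <= _); rewrite mulr_sumr; apply: eq_bigr => p _.
  rewrite mulrCA; congr (_ * _).
  rewrite powRB ?powRr1 ?(ltW t0)//; last by rewrite (gt_eqF t0) implybT.
  by rewrite mulrCA divff ?mulr1// gt_eqF.
- apply: derivable_within_continuous => t; rewrite in_itv/= => /andP[xt _].
  by apply: d; exact: lt_le_trans xt.
Qed.

Lemma powsum_cvg0 (R : realType) (s : seq (R * R)) :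
  {in s, forall p, 0 < p.2} -> powsum s t @[t --> 0^'+] --> (0 : R).
Proof.
elim: s => [|p s IH] hs.
  have -> : (fun t => @powsum R [::] t) = cst 0.
    by apply/funext => x; rewrite /powsum big_nil.
  exact: cvg_cst.
have -> : (fun t => powsum (p :: s) t) = (fun t => p.1 * t `^ p.2 + powsum s t).
  by apply/funext => x; rewrite /powsum big_cons.
rewrite -[X in _ --> X]addr0 -[X in _ --> X + _](mulr0 p.1).
apply: cvgD; last by apply: IH => q qs; apply: hs; rewrite inE qs orbT.
apply: cvgM; first exact: cvg_cst.
by apply: powR_cvg0; apply: hs; rewrite mem_head.
Qed.

(** Positive exponents force the limit 0 at the origin, from which the sum can only increase. *)
Lemma powsum_ge0 (R : realType) (s : seq (R * R)) :
  {in s, forall p, 0 < p.2} ->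
  (forall t, 0 < t -> 0 <= powsum [seq (p.1 * p.2, p.2) | p <- s] t) ->
  forall t, 0 < t -> 0 <= powsum s t.
Proof.
move=> hs h t t0.
have c := powsum_cvg0 hs.
rewrite -(cvg_lim _ c)//.
apply: limr_le; first by apply/cvg_ex; exists 0.
near=> x.
by apply: powsum_nondecreasing => //; near: x; exact: nbhs_right_le.
Unshelve. all: by end_near. Qed.

(* Integrates the hypothesis against [t^(b-1)] over [0, t]. *)
Lemma powsum_shift_ge0 (R : realType) (s : seq (R * R)) (b : R) : 0 < b ->
  {in s, forall p, 0 <= p.2} -> (forall t, 0 < t -> 0 <= powsum s t) ->
  forall t, 0 < t -> 0 <= powsum [seq (p.1 / (p.2 + b), p.2) | p <- s] t.
Proof.
move=> b0 hs h t t0.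
rewrite -(pmulr_lge0 _ (powR_gt0 b t0)).
have E r : {in r, forall p : R * R, 0 <= p.2} -> powsum [seq (p.1 / (p.2 + b), p.2) | p <- r] t * t `^ b =
  powsum [seq (p.1 / (p.2 + b), p.2 + b) | p <- r] t.
  move=> hr.
  rewrite /powsum !big_map mulr_suml; apply: eq_bigr => p _ /=.
  by rewrite powRD ?mulrA// (gt_eqF t0) implybT.
rewrite E//; apply: powsum_ge0 => // [q /mapP[p /hs p2 ->]/=|u u0].
  by rewrite ltr_wpDl.
rewrite -map_comp /=.
suff -> : powsum [seq (p.1 / (p.2 + b) * (p.2 + b), p.2 + b) | p <- s] u = powsum s u * u `^ b.
  by rewrite mulr_ge0 ?h ?powR_ge0.
rewrite /powsum big_map mulr_suml; apply: eq_big_seq => p /hs p2 /=.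
rewrite divfK ?gt_eqF ?ltr_wpDl//.
by rewrite powRD ?mulrA// (gt_eqF u0) implybT.
Qed.

(** * Taylor bounds for the cosine *)

Lemma powsum_cons (R : realType) (p : R * R) s t :
  powsum (p :: s) t = p.1 * t `^ p.2 + powsum s t.
Proof. by rewrite /powsum big_cons. Qed.

Lemma powsum_cat (R : realType) (s1 s2 : seq (R * R)) t :
  powsum (s1 ++ s2) t = powsum s1 t + powsum s2 t.
Proof. by rewrite /powsum big_cat. Qed.

Lemma powsum_opp (R : realType) (s : seq (R * R)) t :
  powsum [seq (- p.1, p.2) | p <- s] t = - powsum s t.
Proof.
by rewrite /powsum big_map -sumrN; apply: eq_bigr => p _; rewrite mulNr.
Qed.

Lemma is_derive_ge0_ge0 (R : realType) (f df : R -> R) :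
  (forall x : R, is_derive x (1 : R) f (df x)) -> (forall x : R, 0 <= x -> 0 <= df x) ->
  f 0 = 0 -> forall x : R, 0 <= x -> 0 <= f x.
Proof.
move=> fdf df0 f0 x x0; rewrite -f0.
have d t : derivable f t 1 by case: (fdf t).
apply: (@ger0_derive1_ndecr R f 0 x) => //.
- by move=> t; rewrite in_itv/= => /andP[/ltW t0 _]; rewrite derive1E derive_val df0.
- by apply: derivable_within_continuous.
Qed.

Definition cos_taylor (R : realType) (n : nat) (x : R) : R :=
  \sum_(j < n) (-1) ^+ j * (x ^+ j.*2 / (j.*2)`!%:R).

Definition sin_taylor (R : realType) (n : nat) (x : R) : R :=
  \sum_(j < n) (-1) ^+ j * (x ^+ (j.*2).+1 / ((j.*2).+1)`!%:R).

(** Start from [cos x <= 1]; integrating from 0 gives the inequality for the sine, and integrating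
    again the next one for the cosine. *)
Lemma cos_sub_taylor_ge0 (R : realType) (n : nat) (x : R) : 0 <= x ->
  0 <= (-1) ^+ n.+1 * (cos x - cos_taylor n.+1 x).
Proof.
have dX k (t : R) : is_derive t (1 : R) (fun y : R => y ^+ k.+1 / (k.+1)`!%:R)
    (t ^+ k / k`!%:R).
  have -> : (fun y : R => y ^+ k.+1 / (k.+1)`!%:R) =
      ((k.+1)`!%:R^-1 : R) *: ((@id R) ^+ k.+1).
    by apply/funext => y; rewrite !fctE -[RHS]/(_ * _) mulrC.
  apply: is_derive_eq.
  rewrite -[_ *: 1]/(_ * 1) -[_ *: _]/(_ * _) /= mulr1.
  rewrite factS natrM invfM.
  have k0 : k.+1%:R != 0 :> R by rewrite pnatr_eq0.
  by rewrite mulrCA mulrA mulrA divff// mul1r mulrC.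
elim: n x => [x _|n IH].
  by rewrite /cos_taylor expr1 big_ord_recl big_ord0 addr0 !expr0 mul1r fact0
    divr1 mulN1r opprB subr_ge0 cos_le1.
have sn : forall x : R, 0 <= x -> 0 <= (-1) ^+ n.+1 * (sin x - sin_taylor n.+1 x).
  apply: (is_derive_ge0_ge0 (df := fun x => (-1) ^+ n.+1 * (cos x - cos_taylor n.+1 x))).
  - move=> t.
    have -> : (fun x : R => (-1) ^+ n.+1 * (sin x - sin_taylor n.+1 x)) =
        (-1) ^+ n.+1 *: (@sin R - \sum_(j < n.+1)
        (-1) ^+ j *: (fun x : R => x ^+ (j.*2).+1 / ((j.*2).+1)`!%:R)).
      by apply/funext => y; rewrite /= !fctE fct_sumE.
    exact: is_deriveZ.
  - exact: IH.
  - rewrite sin0 /sin_taylor big1 ?subrr ?mulr0// => j _.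
    by rewrite exprS mul0r mul0r mulr0.
apply: (is_derive_ge0_ge0 (df := fun x => (-1) ^+ n.+1 * (sin x - sin_taylor n.+1 x))).
- move=> t.
  have -> : (fun x : R => (-1) ^+ n.+2 * (cos x - cos_taylor n.+2 x)) =
      (-1) ^+ n.+2 *: (@cos R - (cst 1 + \sum_(j < n.+1)
      (-1) ^+ j.+1 *: (fun x : R => x ^+ (j.*2).+2 / ((j.*2).+2)`!%:R))).
    apply/funext => y.
    rewrite /cos_taylor big_ord_recl expr0 double0 expr0 fact0 divr1.
    by rewrite mul1r /= !fctE fct_sumE.
  apply: is_derive_eq.
  rewrite add0r -[_ *: _]/(_ * _) exprS mulN1r mulNr -mulrN; congr (_ * _).
  rewrite opprB opprK addrC; congr (_ + _); rewrite -sumrN; apply: eq_bigr => j _.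
  by rewrite exprS mulN1r -[_ *: _]/(_ * _) mulNr.
- exact: sn.
- rewrite cos0 /cos_taylor big_ord_recl big1 => [|j _].
    by rewrite expr0 double0 expr0 fact0 divr1 mul1r addr0 subrr mulr0.
  by rewrite doubleS exprS mul0r mul0r mulr0.
Qed.

Definition cos_tail (R : realType) (m i : nat) (w : R) : R :=
  \sum_(j < i) (-1) ^+ j * (w ^+ (m + j).+1 / ((m + j).+1.*2)`!%:R).

(* [r] is the remainder of order [m] of the Taylor series of [cos (sqrt w)], up
   to sign, and the [cos_tail m i w] are its partial sums. *)
Lemma cos_tail_remainder (R : realType) (m : nat) (w : R) : 0 <= w ->
  exists r : R, [/\ 0 <= r, r <= 2 * (w ^+ m / (m.*2)`!%:R) &
    forall i, 0 <= (-1) ^+ i * (r - cos_tail m i w)].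
Proof.
move=> w0.
pose E n := \sum_(j < n) (-1) ^+ j * (w ^+ j / (j.*2)`!%:R).
have H n : 0 <= (-1) ^+ n.+1 * (cos (Num.sqrt w) - E n.+1).
  have := cos_sub_taylor_ge0 n (sqrtr_ge0 w).
  rewrite /cos_taylor; congr (0 <= _ * (_ - _)); apply: eq_bigr => j _.
  by rewrite -mul2n exprM sqr_sqrtr// mul2n.
have ES n : E n.+1 = E n + (-1) ^+ n * (w ^+ n / (n.*2)`!%:R).
  by rewrite /E big_ord_recr.
have w0' n : 0 <= w ^+ n / (n.*2)`!%:R by rewrite divr_ge0 ?exprn_ge0.
exists ((-1) ^+ m.+1 * (cos (Num.sqrt w) - E m.+1)); split => //.
(* The factor 2 covers [m = 0], where the remainder is [1 - cos]; for larger [m] the sign of the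
   preceding remainder is used. *)
- case: m => [|m].
    rewrite expr1 ES /E big_ord0 !expr0 double0 fact0 divr1 !mul1r add0r mulr1.
    have := cos_geN1 (Num.sqrt w); lra.
  have := H m; have := w0' m.+1; rewrite (ES m.+1).
  set c := cos _; set e := E _; set x := w ^+ m.+1 / _.
  rewrite (exprS _ m.+1) -signr_odd; case: (odd m.+1); rewrite ?expr1 ?expr0; lra.
- move=> i.
  have -> : cos_tail m i w = (-1) ^+ m.+1 * (E (m + i).+1 - E m.+1).
    elim: i => [|i IH]; first by rewrite /cos_tail big_ord0 addn0 subrr mulr0.
    rewrite /cos_tail big_ord_recr /= -/(cos_tail m i w) IH addnS (ES (m + i).+1).
    have -> : (-1) ^+ i = (-1) ^+ m.+1 * (-1) ^+ (m + i).+1 :> R.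
      by rewrite -addSn exprD mulrA -expr2 sqrr_sign mul1r.
    by rewrite -mulrA -mulrDr addrAC.
  rewrite -mulrBr mulrA -exprD.
  by rewrite opprB addrA subrK addnS addnC; exact: H.
Qed.

(** * The truncated cosine integral *)

Definition powopp (R : realType) (s : seq (R * R)) := [seq (- p.1, p.2) | p <- s].

Definition powderiv (R : realType) (s : seq (R * R)) :=
  [seq (p.1 * p.2, p.2) | p <- s].

Lemma powderiv_opp (R : realType) (s : seq (R * R)) :
  powderiv (powopp s) = powopp (powderiv s).
Proof.
by rewrite /powderiv /powopp -!map_comp; apply: eq_map => p /=; rewrite mulNr.
Qed.

(* The antiderivative of [w^(-s-1) * cos_tail m i w] vanishing at 0. *)
Definition cos_kernel (R : realType) (m : nat) (s : R) (i : nat) : seq (R * R) :=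
  [seq ((-1) ^+ j / (((m + j).+1%:R - s) * ((m + j).+1.*2)`!%:R),
        (m + j).+1%:R - s) | j <- iota 0 i].

Section cos_kernel.
Context {R : realType} {m : nat} {s : R}.
Hypothesis ms : m%:R < s < m%:R + 1.

Lemma cos_kernel_expt_gt0 j : 0 < (m + j).+1%:R - s.
Proof.
by rewrite subr_gt0; case/andP: ms => _ /lt_le_trans; apply; rewrite natr1 ler_nat ltnS leq_addr.
Qed.

Lemma powsum_cos_kernel i w :
  powsum (cos_kernel m s i) w =
  \sum_(j < i) (-1) ^+ j / (((m + j).+1%:R - s) * ((m + j).+1.*2)`!%:R) *
    w `^ ((m + j).+1%:R - s).
Proof.
by rewrite /powsum big_map -[i in iota _ i]subn0 -/(index_iota 0 i) big_mkord.
Qed.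

Lemma powsum_cos_kernelS i w :
  powsum (cos_kernel m s i.+1) w = powsum (cos_kernel m s i) w +
  (-1) ^+ i * (w `^ ((m + i).+1%:R - s) /
    (((m + i).+1%:R - s) * ((m + i).+1.*2)`!%:R)).
Proof.
rewrite !powsum_cos_kernel big_ord_recr /=; congr (_ + _).
by rewrite -mulrA [X in _ * X]mulrC.
Qed.

Lemma powderiv_cos_kernel i w : 0 < w ->
  powsum (powderiv (cos_kernel m s i)) w = w `^ (- s) * cos_tail m i w.
Proof.
move=> w0.
rewrite /powsum !big_map -[i in iota _ i]subn0 -/(index_iota 0 i) big_mkord.
rewrite /cos_tail mulr_sumr; apply: eq_bigr => j _ /=.
have e0 := lt0r_neq0 (cos_kernel_expt_gt0 j).
rewrite powRD ?(gt_eqF w0) ?implybT// powR_mulrn ?(ltW w0)//.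
rewrite invfM; set e := _ - s in e0 *.
clearbody e; move: (w ^+ _) (w `^ _) (_%:R^-1) => a b f; by field.
Qed.

Lemma cos_kernel_nondecreasing i x y : odd i -> 0 < x -> x <= y ->
  powsum (cos_kernel m s i) x <= powsum (cos_kernel m s i) y.
Proof.
move=> oi; apply: powsum_nondecreasing => t t0.
rewrite powderiv_cos_kernel// mulr_ge0 ?powR_ge0//.
have [r [r0 _ /(_ i)]] := cos_tail_remainder m (ltW t0).
rewrite -signr_odd oi expr1; lra.
Qed.

(** [C * w^(m - s)] is the integral over [v >= w] of [v^(-s-1)] times the bound [2 v^m / (2m)!] on
    the remainder. *)
Let C : R := 2 / (m.*2)`!%:R / (s - m%:R).

(** For even [i], [cos_tail] lies below the remainder, so the kernel grows no faster than the tail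
    term decreases. *)
Lemma cos_kernel_nonincreasing i x y : ~~ odd i -> 0 < x -> x <= y ->
  powsum (cos_kernel m s i) y + C * y `^ (m%:R - s) <=
  powsum (cos_kernel m s i) x + C * x `^ (m%:R - s).
Proof.
move=> oi x0 xy.
have := @powsum_nondecreasing R ((- C, m%:R - s) :: powopp (cos_kernel m s i)).
rewrite -/(powderiv _) /= -/(powderiv (powopp _)) powderiv_opp.
move=> /(_ _ x y x0 xy); rewrite !powsum_cons !powsum_opp /= => H.
suff : - C * x `^ (m%:R - s) - powsum (cos_kernel m s i) x <=
  - C * y `^ (m%:R - s) - powsum (cos_kernel m s i) y by lra.
apply: H => t t0.
rewrite powsum_cons powsum_opp powderiv_cos_kernel//=.
have -> : - C * (m%:R - s) * t `^ (m%:R - s) =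
    t `^ (- s) * (2 * (t ^+ m / (m.*2)`!%:R)).
  have -> : - C * (m%:R - s) = 2 / (m.*2)`!%:R.
    rewrite -mulrN1 -mulrA mulN1r opprB /C divfK// gt_eqF// subr_gt0.
    by case/andP: ms.
  rewrite powRD ?(gt_eqF t0) ?implybT// powR_mulrn ?(ltW t0)//; ring.
rewrite -mulrBr mulr_ge0 ?powR_ge0//.
have [r [r0 + /(_ i)]] := cos_tail_remainder m (ltW t0).
rewrite -signr_odd (negbTE oi) expr0; lra.
Qed.

(** Odd partial sums lie above the remainder and even ones below it; this is integrated from 0. *)
Lemma cos_kernel_le i i' w : odd i -> ~~ odd i' -> 0 < w ->
  powsum (cos_kernel m s i') w <= powsum (cos_kernel m s i) w.
Proof.
move=> oi oi' w0.
have := @powsum_ge0 R (cos_kernel m s i ++ powopp (cos_kernel m s i')).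
rewrite -/(powderiv _) => /(_ _ _ w w0).
rewrite powsum_cat powsum_opp subr_ge0; apply.
  move=> p; rewrite mem_cat => /orP[/mapP[j _ ->]|/mapP[q /mapP[j _ ->] ->]];
  exact: cos_kernel_expt_gt0.
move=> t t0; rewrite /powderiv map_cat powsum_cat -!/(powderiv _).
rewrite powderiv_opp powsum_opp !powderiv_cos_kernel// -mulrBr.
rewrite mulr_ge0 ?powR_ge0//.
have [r [r0 _ H]] := cos_tail_remainder m (ltW t0).
have := H i; have := H i'.
rewrite -signr_odd (negbTE oi') -(signr_odd _ i) oi expr0 expr1; lra.
Qed.

Lemma cos_kernel_gt0 : 0 < powsum (cos_kernel m s 2) 1.
Proof.
rewrite !powsum_cos_kernelS {1}/powsum big_nil add0r !powR1 expr0 expr1 !mul1r mulN1r.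
rewrite subr_gt0 ltf_pV2 ?posrE ?mulr_gt0 ?cos_kernel_expt_gt0 ?ltr0n ?fact_gt0//.
apply: ltr_pM; rewrite ?ltW ?cos_kernel_expt_gt0//.
  by rewrite ltrD2r ltr_nat addn0 addn1.
by rewrite ltr_nat ltn_pfact ?inE ?double_gt0// addn0 addn1 ltn_double.
Qed.

(** [c] is the integral over [w > 0] of [w^(-s-1)] times the remainder, convergent at 0 since
    [s < m + 1] and at infinity since [m < s]. An odd truncation at [w] misses at most the tail
    beyond [w] and overshoots by at most the integral of the next Taylor term. *)
Lemma cos_kernel_limit : exists c : R, 0 < c /\
  exists C : R, 0 <= C /\ forall i w, odd i -> 0 < w ->
    - (C * w `^ (m%:R - s)) <= powsum (cos_kernel m s i) w - c <=
    w `^ ((m + i).+1%:R - s) / (((m + i).+1%:R - s) * ((m + i).+1.*2)`!%:R).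
Proof.
pose A := [set z : R | exists i w, [/\ ~~ odd i, 0 < w & z = powsum (cos_kernel m s i) w]].
have A1 : A (powsum (cos_kernel m s 2) 1) by exists 2, 1.
have C0 : 0 <= C.
  by rewrite /C divr_ge0 ?divr_ge0// subr_ge0 ltW//; case/andP: ms.
have ubA i w : odd i -> 0 < w ->
    ubound A (powsum (cos_kernel m s i) w + C * w `^ (m%:R - s)).
  move=> oi w0 _ [i' [w' [oi' w'0 ->]]].
  have cw : 0 <= C * w `^ (m%:R - s) by rewrite mulr_ge0 ?powR_ge0.
  have [ww'|w'w] := leP w w'.
    have := cos_kernel_nonincreasing oi' w0 ww'.
    have := cos_kernel_le oi oi' w0.
    have : 0 <= C * w' `^ (m%:R - s) by rewrite mulr_ge0 ?powR_ge0.
    lra.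
  have := cos_kernel_le oi oi' w'0.
  have := cos_kernel_nondecreasing oi w'0 (ltW w'w).
  lra.
have hsA : has_sup A.
  split; first by exists (powsum (cos_kernel m s 2) 1).
  by exists (powsum (cos_kernel m s 1) 1 + C * 1 `^ (m%:R - s)); exact: ubA.
(* [sup A] is the limit at infinity of the integral of the full kernel. *)
exists (sup A); split.
  by rewrite (lt_le_trans cos_kernel_gt0)//; exact: ub_le_sup hsA.2 _ A1.
exists C; split => // i w oi w0; apply/andP; split.
  have : sup A <= powsum (cos_kernel m s i) w + C * w `^ (m%:R - s).
    by apply: ge_sup; [exact: hsA.1|exact: ubA].
  lra.
have : powsum (cos_kernel m s i.+1) w <= sup A.
  by apply: ub_le_sup; [exact: hsA.2|exists i.+1, w; rewrite /= oi].
rewrite powsum_cos_kernelS -signr_odd oi expr1; lra.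
Qed.

End cos_kernel.

(** * The Gamma function *)

Section Gamma_integrand.
Context {R : realType}.
Notation mu := (@lebesgue_measure R).
Implicit Types x y t : R.

(** Raising [t <= 2 y exp(t / (2 y))] to the power [y] uses up half of the exponential decay and
    leaves the other half for integrability. *)
Lemma powR_expR_le y t : 0 <= y -> 0 <= t ->
  t `^ y * expR (- t) <= (2 * y) `^ y * expR (- 2^-1 * t).
Proof.
rewrite le_eqVlt => /predU1P[<- t0|y0 t0].
  by rewrite mulr0 !powRr0 !mul1r ler_expR mulNr lerN2; lra.
have -> : expR (- t) = expR (- 2^-1 * t) * (expR (t / (2 * y)) `^ y)^-1.
  rewrite -expRM -expRN -expRD; congr expR; field; lra.
rewrite mulrCA [leRHS]mulrC ler_wpM2l ?expR_ge0//.
rewrite ler_pdivrMr ?powR_gt0 ?expR_gt0//.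
rewrite -powRM ?expR_ge0 ?mulr_ge0 ?(ltW y0)//.
rewrite ge0_ler_powR ?nnegrE ?(ltW y0)// ?mulr_ge0 ?expR_ge0 ?(ltW y0)//.
have := expR_ge1Dx (t / (2 * y)).
have y2 : 0 < 2 * y by lra.
rewrite -(ler_pM2l y2) mulrDr mulr1 mulrCA divff ?mulr1 ?gt_eqF//; lra.
Qed.

Lemma integrable_expRM (a : R) : 0 < a ->
  mu.-integrable `]0, +oo[ (EFin \o (fun t => a * expR (- a * t))).
Proof.
move=> a0.
have i : mu.-integrable `]0, +oo[ (EFin \o exponential_pdf a).
  by apply: integrableS (integrable_exponential_pdf _).
apply: eq_integrable i => // t; rewrite inE /= in_itv/= andbT => t0.
by rewrite /exponential_pdf patchE mem_set//= in_itv/= andbT ltW.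
Qed.

Lemma integrable_scale (k : R) (f : R -> R) :
  mu.-integrable `]0, +oo[ (EFin \o f) ->
  mu.-integrable `]0, +oo[ (EFin \o (fun t => k * f t)).
Proof. by move=> i; exact: (integrableZl _ k i). Qed.

Lemma Rintegral_expRM (a : R) : 0 < a ->
  \int[mu]_(t in `]0, +oo[) (a * expR (- a * t)) = 1.
Proof.
move=> a0.
have <- : fine (\int[mu]_x (exponential_pdf a x)%:E) = 1.
  by rewrite integral_exponential_pdf.
rewrite Rintegral_itv_obnd_cbnd; last exact: integrable_expRM.
by rewrite Rintegral_mkcond.
Qed.

Lemma integrable_powR_expR y : 0 <= y ->
  mu.-integrable `]0, +oo[ (EFin \o (fun t => t `^ y * expR (- t))).
Proof.
move=> y0.
have i2 := @integrable_expRM 2^-1 ltac:(lra).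
apply: le_integrable (integrableZl _ (2 * (2 * y) `^ y) i2) => //.
- apply/measurable_EFinP/measurable_funM.
    by apply: measurable_funTS; exact: measurable_powR.
  by apply: measurableT_comp => //.
- move=> t /=; rewrite in_itv/= andbT => t0.
  rewrite lee_fin !ger0_norm; last 2 first.
  - by rewrite !mulr_ge0 ?powR_ge0 ?expR_ge0.
  - by rewrite mulr_ge0 ?powR_ge0 ?expR_ge0.
  rewrite mulrACA divff ?mul1r//.
  by rewrite (le_trans (powR_expR_le y0 (ltW t0))).
Qed.

Lemma powR_cvg_right0 y : 0 <= y -> t `^ y @[t --> 0^'+] --> (0 : R) `^ y.
Proof.
rewrite le_eqVlt => /predU1P[<-|y0].
  by under eq_fun do rewrite powRr0; rewrite powRr0; exact: cvg_cst.
by rewrite powR0 ?gt_eqF//; exact: powR_cvg0.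
Qed.

Lemma is_derive_expRM (a t : R) :
  is_derive t (1 : R) (fun u => expR (a * u)) (a * expR (a * t)).
Proof.
rewrite mulrC.
have -> : (fun u => expR (a * u)) = expR \o (a *: id) by [].
apply: is_derive1_comp.
by apply: is_derive_eq; rewrite -[_ *: _]/(_ * _) mulr1.
Qed.

Lemma continuous_expRM (a : R) : continuous (fun u => expR (a * u)).
Proof.
move=> t; apply/differentiable_continuous/derivable1_diffP.
by case: (is_derive_expRM a t).
Qed.

Lemma cvg_expRM_pinfty (a : R) : 0 < a -> expR (- a * t) @[t --> +oo] --> 0.
Proof.
move=> a0.
have -> : (fun t => expR (- a * t)) = (fun z => expR (- z)) \o (fun z => a * z).
  by apply/funext => t; rewrite /= mulNr.
apply: (@cvg_comp _ _ _ _ _ _ (pinfty_nbhs R)); last exact: cvgr_expR.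
by apply: gt0_cvgMry => //; exact: cvg_id.
Qed.

(* Adding a multiple of [expR (- t / 2)] to the derivative of
   [- t `^ x * expR (- t)] makes it nonnegative. *)
Lemma GammaS x : 1 <= x -> Gamma (x + 1) = x * Gamma x.
Proof.
move=> x1.
have x0 : 0 < x by lra.
have y0 : 0 <= x - 1 by lra.
(* [K] makes the added exponential equal to [x] times the bound of [powR_expR_le] at exponent
   [x - 1], which dominates the negative term of [f]. *)
pose K := 2 * x * (2 * (x - 1)) `^ (x - 1).
pose f t := K * (2^-1 * expR (- 2^-1 * t)) +
  (t `^ x * expR (- 1 * t) - x * (t `^ (x - 1) * expR (- 1 * t))).
pose F t := - K * expR (- 2^-1 * t) - t `^ x * expR (- 1 * t).
have f0 t : 0 <= t -> 0 <= f t.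
  move=> t0; rewrite /f mulN1r.
  have := powR_expR_le y0 t0.
  have : 0 <= t `^ x * expR (- t) by rewrite mulr_ge0 ?powR_ge0 ?expR_ge0.
  have -> : K * (2^-1 * expR (- 2^-1 * t)) =
    x * ((2 * (x - 1)) `^ (x - 1) * expR (- 2^-1 * t)) by rewrite /K; field.
  by move=> + h; move: h; rewrite -(ler_pM2l x0); lra.
have powc y : 0 <= y -> {within `[0, +oo[, continuous (fun t : R => t `^ y)}.
  move=> y00; apply/continuous_within_itvcyP; split; last exact: powR_cvg_right0.
  move=> t; rewrite in_itv/= andbT => t0.
  apply/differentiable_continuous/derivable1_diffP.
  by case: (is_derive1_powR y t0).
have exc a : {within `[0, +oo[, continuous (fun t : R => expR (a * t))}.
  by apply: continuous_subspaceT; exact: continuous_expRM.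
have cf : {within `[0, +oo[, continuous f}.
  move=> t; apply: cvgD; first by apply: cvgMr; apply: cvgMr; exact: exc.
  apply: cvgB; first by apply: cvgM; [exact: powc (ltW x0) _|exact: exc].
  by apply: cvgMr; apply: cvgM; [exact: powc y0 _|exact: exc].
have dF t : 0 < t -> is_derive t (1 : R) F (f t).
  move=> t0.
  have d1 := is_derive_expRM (- 2^-1) t.
  have d2 := is_derive_expRM (- 1) t.
  have d3 := is_derive1_powR x t0.
  have -> : F = (- K) *: (fun t => expR (- 2^-1 * t)) -
    (fun t => t `^ x) * (fun t => expR (- 1 * t)) by [].
  apply: is_derive_eq.
  rewrite /f -![_ *: _]/(_ * _) !mulN1r.
  by field.
have F0 : F 0 = - K.
  by rewrite /F powR0 ?gt_eqF// !mulr0 expR0 mul0r mulr1 subr0.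
have Fy : F t @[t --> +oo] --> 0.
  rewrite -[0]subr0 -[in X in _ --> X - _](mulr0 (- K)).
  apply: cvgB; first by apply: cvgMr; apply: cvg_expRM_pinfty; lra.
  apply: (@squeeze_cvgr _ _ _ _ (cst 0) (fun t => (2 * x) `^ x * expR (- 2^-1 * t))).
  - near=> t; rewrite mulr_ge0 ?powR_ge0 ?expR_ge0//= mulN1r.
    by apply: powR_expR_le; [exact: ltW|near: t; exact: nbhs_pinfty_ge].
  - exact: cvg_cst.
  - rewrite -[in X in _ --> X](mulr0 ((2 * x) `^ x)).
    by apply: cvgMr; apply: cvg_expRM_pinfty; lra.
have Fr : F t @[t --> 0^'+] --> F 0.
  apply: cvgB.
    by apply: cvgMr; apply: cvg_at_right_filter; exact: continuous_expRM.
  apply: cvgM; first exact: powR_cvg_right0 (ltW x0).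
  by apply: cvg_at_right_filter; exact: continuous_expRM.
have := @Rintegral_ge0_continuous_FTC2y R f F 0 0 f0 cf Fy.
have dF1 t : 0 < t -> derivable F t 1 by move=> t0; case: (dF t t0).
have dF2 : {in `]0, +oo[, F^`()%classic =1 f}.
  by move=> t; rewrite in_itv/= andbT => t0; rewrite derive1E; case: (dF t t0).
move=> /(_ dF1 Fr dF2); rewrite F0 sub0r opprK.
have i1 := integrable_powR_expR (ltW x0).
have i2 := integrable_powR_expR y0.
have i3 := @integrable_expRM 2^-1 ltac:(lra).
have e1 : f = fun t => K * (2^-1 * expR (- 2^-1 * t)) +
  (t `^ x * expR (- t) - x * (t `^ (x - 1) * expR (- t))).
  by apply/funext => t; rewrite /f mulN1r.
have i4 := integrable_scale K i3.
have i5 := integrable_scale x i2.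
have i6 : mu.-integrable `]0, +oo[ (EFin \o (fun t => t `^ x * expR (- t) -
    x * (t `^ (x - 1) * expR (- t)))) by exact: integrableB i1 i5.
rewrite -Rintegral_itv_obnd_cbnd; last by rewrite e1; exact: integrableD i4 i6.
(* The added exponential integrates to [K = - F 0], so it cancels. *)
rewrite e1 RintegralD// RintegralZl// Rintegral_expRM; last by lra.
rewrite mulr1 RintegralB// RintegralZl// => /eqP.
rewrite -subr_eq0 addrAC subrr add0r subr_eq0 => /eqP.
by rewrite /Gamma addrK.
Unshelve. all: by end_near. Qed.

Lemma Gamma1 : Gamma (1 : R) = 1.
Proof.
rewrite -[RHS](Rintegral_expRM ltr01) /Gamma; apply: eq_Rintegral => t _.
by rewrite subrr powRr0 !mul1r mulN1r.
Qed.

(* Tangent line at [x] of the concave function [t `^ a]. *)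
Lemma powR_le_tangent (a x t : R) : 0 <= a <= 1 -> 0 < x -> 0 < t ->
  t `^ a * x `^ (1 - a) <= a * t + (1 - a) * x.
Proof.
move=> /andP[a0 a1] x0 t0.
have := concave_ln (Itv01 a0 a1) t0 x0.
rewrite !convRE /= => h.
have m0 : 0 < a * t + (1 - a) * x.
  have [->|a0'] := eqVneq a 0; first by rewrite mul0r subr0 mul1r add0r.
  by rewrite ltr_wpDr ?mulr_ge0 ?subr_ge0 ?(ltW x0)// mulr_gt0// lt0r a0'.
rewrite -ler_ln ?posrE ?mulr_gt0 ?powR_gt0// lnM ?posrE ?powR_gt0//.
by rewrite !ln_powR.
Qed.

(** A form of log-convexity: the tangent inequality is integrated against [t^(x-1) e^(-t)], and
    [GammaS] reduces the right side to [x * Gamma x]. *)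
Lemma GammaD_le x a : 1 <= x -> 0 <= a <= 1 -> Gamma (x + a) <= x `^ a * Gamma x.
Proof.
move=> x1 a01; have /andP[a0 a1] := a01.
have x0 : 0 < x by lra.
have ix := integrable_powR_expR (ltW x0).
have ix1 := @integrable_powR_expR (x - 1) ltac:(lra).
have ixa := @integrable_powR_expR (x + a - 1) ltac:(lra).
have j1 := integrable_scale a ix.
have j2 := integrable_scale ((1 - a) * x) ix1.
have : x `^ (1 - a) * Gamma (x + a) <= a * Gamma (x + 1) + (1 - a) * x * Gamma x.
  rewrite /Gamma addrK -!RintegralZl// -RintegralD//.
  apply: le_Rintegral => //; [exact: integrable_scale|exact: integrableD j1 j2|].
  move=> t /=; rewrite in_itv/= andbT => t0.
  have := powR_le_tangent a01 x0 t0.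
  rewrite -(ler_pM2r (mulr_gt0 (powR_gt0 (x - 1) t0) (expR_gt0 (- t)))).
  have -> : t `^ (x + a - 1) = t `^ a * t `^ (x - 1).
    by rewrite -powRD ?(gt_eqF t0) ?implybT//; congr (_ `^ _); lra.
  have -> : t `^ x = t * t `^ (x - 1) by rewrite mulr_powRB1// ltW.
  lra.
rewrite GammaS// => h.
rewrite -(ler_pM2l (powR_gt0 (1 - a) x0)) (le_trans h)//.
rewrite [leRHS]mulrA -powRD ?(gt_eqF x0) ?implybT// subrK powRr1 ?(ltW x0)//.
lra.
Qed.

Lemma Gamma_natr n : Gamma (n%:R + 1) = n`!%:R :> R.
Proof.
elim: n => [|n IH]; first by rewrite add0r Gamma1 fact0.
rewrite -natr1 GammaS ?IH; last by rewrite lerDr.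
by rewrite factS natrM natr1.
Qed.

(** [GammaD_le] bounds the value at the next integer, a factorial, by a positive multiple of
    [Gamma x]. *)
Lemma Gamma_gt0 x : 1 <= x -> 0 < Gamma x.
Proof.
move=> x1.
have x0 : 0 <= x by lra.
have [n /andP[nx xn]] : exists n, n%:R <= x < n%:R + 1.
  by exists (Num.truncn x); rewrite natr1 truncn_itv.
have : Gamma (x + (n%:R + 1 - x)) <= x `^ (n%:R + 1 - x) * Gamma x.
  by apply: GammaD_le => //; apply/andP; split; lra.
rewrite addrC subrK Gamma_natr => h.
rewrite -(pmulr_rgt0 _ (powR_gt0 (n%:R + 1 - x) (lt_le_trans ltr01 x1))).
by rewrite (lt_le_trans _ h)// ltr0n fact_gt0.
Qed.

Lemma GammaD_ge x a : 1 <= x -> 0 <= a <= 1 ->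
  x * Gamma x <= (x + a) `^ (1 - a) * Gamma (x + a).
Proof.
move=> x1 /andP[a0 a1]; rewrite -GammaS//.
have -> : x + 1 = x + a + (1 - a) by lra.
by apply: GammaD_le; [lra|apply/andP; split; lra].
Qed.

End Gamma_integrand.

(** * Legendre duplication *)

Lemma le_of_le_natinv (R : realType) (c u v : R) : 0 < c -> 0 < v ->
  (forall n, u <= (1 + c / n.+1%:R) * v) -> u <= v.
Proof.
move=> c0 v0 h; rewrite leNgt; apply/negP => vu.
have uv : 0 < u - v by rewrite subr_gt0.
have d0 : 0 <= c * v / (u - v) by rewrite divr_ge0 ?mulr_ge0 ?ltW.
pose n := Num.truncn (c * v / (u - v)).
have := h n; rewrite leNgt => /negP; apply.
have := truncnS_gt (c * v / (u - v)); rewrite -/n ltr_pdivrMr// => h1.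
have n0 : 0 < n.+1%:R :> R by rewrite ltr0n.
rewrite mulrDl mul1r -ltrBrDl mulrAC ltr_pdivrMr// mulrC.
by rewrite mulrC (mulrC (u - v)).
Qed.

Section duplication.
Context {R : realType}.
Implicit Types x y a : R.

(* Legendre's duplication formula says that this ratio is constant: it is
   1-periodic, and log-convexity of [Gamma] makes it tend to a limit. *)
Definition dup_ratio (x : R) : R := Gamma (2 * x) / (4 `^ x * Gamma x * Gamma (x + 2^-1)).

Lemma powR_ler (a b r : R) : 0 <= r -> 0 <= a -> a <= b -> a `^ r <= b `^ r.
Proof. by move=> r0 a0 ab; rewrite ge0_ler_powR ?nnegrE// (le_trans a0). Qed.

Lemma GammaD_le_ub x a b : 1 <= x -> 0 <= a <= 1 -> x <= b ->
  Gamma (x + a) <= b `^ a * Gamma x.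
Proof.
move=> x1 a01 xb; apply: (le_trans (GammaD_le x1 a01)).
rewrite ler_pM2r ?Gamma_gt0// powR_ler//; first by case/andP: a01.
exact: le_trans x1.
Qed.

Lemma GammaD_ge_ub x a b c : 1 <= x -> 0 <= a <= 1 -> c <= x -> x + a <= b ->
  c * Gamma x <= b `^ (1 - a) * Gamma (x + a).
Proof.
move=> x1 a01 cx xab; have /andP[a0 a1] := a01.
apply: (@le_trans _ _ (x * Gamma x)); first by rewrite ler_pM2r ?Gamma_gt0.
apply: (le_trans (GammaD_ge x1 a01)).
have xa1 : 1 <= x + a by rewrite (le_trans x1)// lerDl.
by rewrite ler_pM2r ?Gamma_gt0// powR_ler ?subr_ge0// (le_trans _ xa1).
Qed.

(** Algebra for [dup_ratioD_le]: [G1], [G2], [G3] stand for [Gamma] at [2 y], [y], [y + 1/2], the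
    [H] for the same with [y + a] in place of [y], and [F], [Fa] for [4^y], [4^a]. [dup_lower] uses
    the same letters. *)
Lemma dup_upper (y G1 G2 G3 H1 H2 H3 F Fa P Q : R) :
  0 < y -> 0 < G1 -> 0 < G2 -> 0 < G3 -> 0 < H1 -> 0 < H2 -> 0 < H3 -> 0 < F ->
  0 < Fa -> H1 <= P * G1 -> y * G2 <= Q * H2 -> y * G3 <= Q * H3 ->
  P * (Q * Q) <= Fa * (y + 1) ^+ 2 ->
  H1 / (F * Fa * H2 * H3) <= ((y + 1) / y) ^+ 2 * (G1 / (F * G2 * G3)).
Proof.
move=> y0 g1 g2 g3 h1 h2 h3 f0 fa0 hA hB hC hD.
have yG2 := mulr_gt0 y0 g2; have yG3 := mulr_gt0 y0 g3.
rewrite ler_pdivrMr ?mulr_gt0//.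
have -> : ((y + 1) / y) ^+ 2 * (G1 / (F * G2 * G3)) * (F * Fa * H2 * H3) =
   (Fa * (y + 1) ^+ 2 * (G1 * H2 * H3)) / (y * G2 * (y * G3)).
  by field; rewrite !lt0r_neq0.
rewrite ler_pdivlMr ?mulr_gt0//.
have hBC := ler_pM (ltW yG2) (ltW yG3) hB hC.
apply: (le_trans (ler_pM (ltW h1) (ltW (mulr_gt0 yG2 yG3)) hA hBC)).
have -> : P * G1 * (Q * H2 * (Q * H3)) = P * (Q * Q) * (G1 * H2 * H3) by ring.
by rewrite ler_pM2r ?mulr_gt0.
Qed.

Lemma dup_lower (y G1 G2 G3 H1 H2 H3 F Fa P Q : R) :
  0 < y -> 0 < G1 -> 0 < G2 -> 0 < G3 -> 0 < H1 -> 0 < H2 -> 0 < H3 -> 0 < F ->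
  0 < Fa -> 2 * y * G1 <= P * H1 -> H2 <= Q * G2 -> H3 <= Q * G3 ->
  Fa * (P * (Q * Q)) = 2 * (y + 1) ->
  G1 / (F * G2 * G3) <= (y + 1) / y * (H1 / (F * Fa * H2 * H3)).
Proof.
move=> y0 g1 g2 g3 h1 h2 h3 f0 fa0 hA hB hC hD.
have yG1 : 0 < 2 * y * G1 by rewrite !mulr_gt0.
rewrite ler_pdivrMr ?mulr_gt0//.
have -> : (y + 1) / y * (H1 / (F * Fa * H2 * H3)) * (F * G2 * G3) =
   (2 * (y + 1) * (H1 * G2 * G3)) / (Fa * (2 * y * (H2 * H3))).
  by field; rewrite !lt0r_neq0.
rewrite ler_pdivlMr ?mulr_gt0// -hD.
have hBC := ler_pM (ltW h2) (ltW h3) hB hC.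
have := ler_pM (ltW yG1) (ltW (mulr_gt0 h2 h3)) hA hBC.
rewrite -(ler_pM2l fa0); congr (_ <= _); ring.
Qed.

Lemma dup_ratio_gt0 x : 1 <= x -> 0 < dup_ratio x.
Proof.
move=> x1; rewrite /dup_ratio divr_gt0 ?mulr_gt0 ?powR_gt0 ?Gamma_gt0//; lra.
Qed.

Lemma dup_ratioS x : 1 <= x -> dup_ratio (x + 1) = dup_ratio x.
Proof.
move=> x1; rewrite /dup_ratio.
have -> : 2 * (x + 1) = 2 * x + 1 + 1 by ring.
have -> : x + 1 + 2^-1 = x + 2^-1 + 1 by ring.
rewrite (@GammaS _ (2 * x + 1)) ?(@GammaS _ (2 * x)) ?(@GammaS _ x) ?(@GammaS _ (x + 2^-1)); try lra.
rewrite powRD ?pnatr_eq0 ?implybT// powRr1//.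
have g1 := Gamma_gt0 x1.
have g2 : 0 < Gamma (x + 2^-1) by apply: Gamma_gt0; lra.
have g3 : (0 : R) < 4 `^ x by rewrite powR_gt0.
move: (Gamma (2 * x)) (Gamma x) (Gamma (x + 2^-1)) (4 `^ x) g1 g2 g3 => a b c d b0 c0 d0.
field; rewrite !lt0r_neq0//; lra.
Qed.

Lemma powR4 a : (4 : R) `^ a = 2 `^ (2 * a).
Proof. by rewrite powRrM powR_mulrn//; congr (_ `^ _); ring. Qed.

Lemma dup_ratioD_le y a : 1 <= y -> 0 <= a <= 2^-1 ->
  dup_ratio (y + a) <= ((y + 1) / y) ^+ 2 * dup_ratio y.
Proof.
move=> y1 /andP[a0 a1].
have y0 : 0 < y by lra.
rewrite /dup_ratio mulrDr powRD ?pnatr_eq0 ?implybT//.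
apply: (@dup_upper _ _ _ _ _ _ _ _ _ ((2 * y) `^ (2 * a)) ((y + 1) `^ (1 - a)));
  try (by apply: Gamma_gt0; lra); try (by apply: powR_gt0); first by [].
- by apply: GammaD_le; [lra|apply/andP; split; lra].
- by apply: GammaD_ge_ub; [lra|apply/andP; split; lra|lra|lra].
- rewrite (addrAC y a).
  by apply: GammaD_ge_ub; [lra|apply/andP; split; lra|lra|lra].
have y10 : (y + 1 == 0) = false by rewrite gt_eqF//; lra.
have -> : (2 * y) `^ (2 * a) = 4 `^ a * y `^ (2 * a).
  by rewrite powRM ?powR4//; lra.
rewrite -mulrA ler_pM2l ?powR_gt0//.
apply: (@le_trans _ _ ((y + 1) `^ (2 * a) * ((y + 1) `^ (1 - a) * (y + 1) `^ (1 - a)))).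
  by rewrite ler_wpM2r ?mulr_ge0 ?powR_ge0// powR_ler//; lra.
rewrite -!powRD ?y10 ?implybT// -powR_mulrn; last by lra.
by rewrite le_eqVlt; apply/orP; left; apply/eqP; congr (_ `^ _); ring.
Qed.

Lemma dup_ratioD_ge y a : 1 <= y -> 0 <= a <= 2^-1 ->
  dup_ratio y <= ((y + 1) / y) * dup_ratio (y + a).
Proof.
move=> y1 /andP[a0 a1].
have y0 : 0 < y by lra.
rewrite /dup_ratio mulrDr powRD ?pnatr_eq0 ?implybT//.
apply: (@dup_lower _ _ _ _ _ _ _ _ _ ((2 * (y + 1)) `^ (1 - 2 * a)) ((y + 1) `^ a));
  try (by apply: Gamma_gt0; lra); try (by apply: powR_gt0); first by [].
- by apply: GammaD_ge_ub; [lra|apply/andP; split; lra|lra|lra].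
- by apply: GammaD_le_ub; [lra|apply/andP; split; lra|lra].
- rewrite (addrAC y a).
  by apply: GammaD_le_ub; [lra|apply/andP; split; lra|lra].
have y10 : (y + 1 == 0) = false by rewrite gt_eqF//; lra.
rewrite powRM//; last by lra.
rewrite powR4 -mulrA mulrA -!powRD ?y10 ?pnatr_eq0 ?implybT//.
have -> : 2 * a + (1 - 2 * a) = 1 by ring.
have -> : 1 - 2 * a + (a + a) = 1 by ring.
by rewrite !powRr1//; lra.
Qed.

Lemma dup_ratioDn x n : 1 <= x -> dup_ratio (x + n%:R) = dup_ratio x.
Proof.
move=> x1; elim: n => [|n IH]; first by rewrite addr0.
rewrite -natr1 addrA dup_ratioS ?IH//.
by rewrite (le_trans x1)// lerDl.
Qed.

(** By periodicity the comparison can be made at [x + n + 1] for every [n], and there the distortion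
    factors tend to 1. *)
Lemma dup_ratioD x a : 1 <= x -> 0 <= a <= 2^-1 -> dup_ratio (x + a) = dup_ratio x.
Proof.
move=> x1 a01; have /andP[a0 a1] := a01.
have xa1 : 1 <= x + a by lra.
have K n : ((x + n.+1%:R + 1) / (x + n.+1%:R)) <= 1 + 1 / n.+1%:R.
  have n0 : 0 < n.+1%:R :> R by rewrite ltr0n.
  rewrite ler_pdivrMr; last lra.
  rewrite mulrDl !mul1r lerD2l ler_pdivlMl//; lra.
apply/eqP; rewrite eq_le; apply/andP; split.
(* The 3 comes from [(1 + 1/n)^2 <= 1 + 3/n] for [n >= 1]. *)
- apply: (@le_of_le_natinv _ 3); rewrite ?dup_ratio_gt0// => n.
  have y1 : 1 <= x + n.+1%:R by rewrite (le_trans x1)// lerDl.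
  have := dup_ratioD_le y1 a01.
  rewrite (addrAC x n.+1%:R a) !dup_ratioDn// => h; apply: (le_trans h).
  rewrite ler_wpM2r ?(ltW (dup_ratio_gt0 _))//.
  have n0 : 1 <= n.+1%:R :> R by rewrite ler1n.
  apply: (@le_trans _ _ ((1 + 1 / n.+1%:R) ^+ 2)).
    by rewrite lerXn2r ?nnegrE ?K// ?addr_ge0// divr_ge0//; lra.
  rewrite -subr_ge0 (_ : _ - _ = (n.+1%:R - 1) / n.+1%:R ^+ 2).
    by rewrite divr_ge0 ?exprn_ge0// subr_ge0.
  by move: (n.+1%:R : R) n0 => z z1; field; lra.
- apply: (@le_of_le_natinv _ 1); rewrite ?dup_ratio_gt0// => n.
  have y1 : 1 <= x + n.+1%:R by rewrite (le_trans x1)// lerDl.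
  have := dup_ratioD_ge y1 a01.
  rewrite (addrAC x n.+1%:R a) !dup_ratioDn// => h; apply: (le_trans h).
  by rewrite ler_wpM2r ?K// (ltW (dup_ratio_gt0 _)).
Qed.

(** [x] is reached from 1 by steps of 1/2 and one last shorter step. *)
Lemma dup_ratio_cst x : 1 <= x -> dup_ratio x = dup_ratio 1.
Proof.
move=> x1.
have H n : dup_ratio (1 + n%:R / 2) = dup_ratio 1.
  elim: n => [|n <-]; first by rewrite mul0r addr0.
  rewrite -natr1 mulrDl addrA dup_ratioD ?lerDl ?divr_ge0//.
  by apply/andP; split; lra.
pose n := Num.truncn (2 * (x - 1)).
have /andP[n1 n2] : n%:R <= 2 * (x - 1) < n.+1%:R by rewrite truncn_itv//; lra.
have -> : x = 1 + n%:R / 2 + (x - 1 - n%:R / 2) by ring.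
rewrite dup_ratioD ?H ?lerDl ?divr_ge0//.
move: n1 n2; rewrite -(natr1 n); move: (n%:R : R) => z n1 n2.
by apply/andP; split; lra.
Qed.

End duplication.

(** * The limiting moments *)

Section moment.
Context {R : realType}.
Notation mu := (@lebesgue_measure R).

(* The moment of order [2 s] of [sqrt U * N] for independent [U] uniform on
   [0, 1] and [N] standard Gaussian. *)
Definition moment (s : R) : R := Gamma (2 * s + 1) / (Gamma (s + 2) * 2 `^ s).

Lemma moment_ge0 s : 0 <= s -> 0 <= moment s.
Proof.
move=> s0; rewrite /moment divr_ge0 ?mulr_ge0 ?powR_ge0//; apply/ltW/Gamma_gt0; lra.
Qed.

Lemma moment_natr n : moment n%:R = ((n.*2)`!%:R / ((n.+1)`!%:R * 2 ^+ n)).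
Proof.
rewrite /moment -natrM mul2n Gamma_natr powR_mulrn//.
have -> : n%:R + 2 = n.+1%:R + 1 :> R by rewrite -(natr1 n); ring.
by rewrite Gamma_natr.
Qed.

(** Duplication at [s + 1]. The quotient of [Gamma (s + 3/2)] by [s + 1/2] is left unsimplified so
    that the integrand of [Gamma] has a nonnegative exponent down to [s = 0]; both divisions are of
    the kind treated by [powsum_shift_ge0]. *)
Lemma momentE s : 0 <= s ->
  moment s = 2 * dup_ratio (1 : R) *
    (2 `^ s * Gamma (s + 1 + 2^-1) / (s + 2^-1) / (s + 1)).
Proof.
move=> s0.
have s1 : 1 <= s + 1 by lra.
rewrite -(dup_ratio_cst s1) /dup_ratio /moment.
have -> : 2 * (s + 1) = 2 * s + 1 + 1 by ring.
have -> : s + 2 = s + 1 + 1 by ring.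
have h2 : 1 <= 2 * s + 1 by lra.
rewrite (GammaS h2) (GammaS s1).
have -> : (4 : R) `^ (s + 1) = 4 * (2 `^ s * 2 `^ s).
  rewrite powRD ?pnatr_eq0 ?implybT// powRr1// mulrC powR4; congr (_ * _).
  by rewrite -powRD ?pnatr_eq0 ?implybT//; congr (_ `^ _); ring.
have g1 := Gamma_gt0 s1.
have h3 : 1 <= s + 1 + 2^-1 by lra.
have g2 := Gamma_gt0 h3.
have g3 : (0 : R) < 2 `^ s by rewrite powR_gt0.
move: g1 g2 g3; move: (Gamma (s + 1)) (Gamma (s + 1 + 2^-1)) (2 `^ s) (Gamma (2 * s + 1)).
move=> {h2 h3} a b c d a0 b0 c0.
by field; rewrite !lt0r_neq0//; lra.
Qed.

(** [J e] is thought of as the moment of order [e] of a positive measure on the half-line. Retaining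
    only positivity treats the limiting law and the mean over [x] alike. *)
Definition pos_on_powers (J : R -> R) := forall l : seq (R * R),
  {in l, forall p, 0 <= p.2} -> (forall t, 0 <= t -> 0 <= powsum l t) ->
  0 <= \sum_(p <- l) p.1 * J p.2.

Let g (l : seq (R * R)) (t : R) : R := powsum l (2 * t) * (t `^ 2^-1 * expR (- t)).

(** Up to normalisation, these are the moments of twice a Gamma variable of shape 3/2. *)
Lemma powsum_Gamma (l : seq (R * R)) : {in l, forall p, 0 <= p.2} ->
  mu.-integrable `]0, +oo[ (EFin \o g l) /\
  \int[mu]_(t in `]0, +oo[) g l t =
    \sum_(p <- l) p.1 * (2 `^ p.2 * Gamma (p.2 + 1 + 2^-1)).
Proof.
elim: l => [|p l IH] hl.
  have -> : g [::] = cst 0 by apply/funext => t; rewrite /g /powsum big_nil mul0r.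
  by split; [exact: integrable0|rewrite Rintegral_cst// mul0r big_nil].
have p0 : 0 <= p.2 by apply: hl; rewrite mem_head.
have [i1 e1] : mu.-integrable `]0, +oo[ (EFin \o g l) /\
  \int[mu]_(t in `]0, +oo[) g l t =
    \sum_(p <- l) p.1 * (2 `^ p.2 * Gamma (p.2 + 1 + 2^-1)).
  by apply: IH => q ql; apply: hl; rewrite inE ql orbT.
have q0 : 0 <= p.2 + 2^-1 by lra.
have i2 := integrable_scale (p.1 * 2 `^ p.2) (integrable_powR_expR q0).
pose h t := p.1 * 2 `^ p.2 * (t `^ (p.2 + 2^-1) * expR (- t)) + g l t.
have gh : {in `]0, +oo[%classic, h =1 g (p :: l)}.
  move=> t; rewrite inE /= in_itv/= andbT => t0; rewrite /h /g powsum_cons [RHS]mulrDl.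
  congr (_ + _); rewrite powRM ?(ltW t0)// powRD ?(gt_eqF t0) ?implybT//; ring.
split.
  have ih : mu.-integrable `]0, +oo[ (EFin \o h) by exact: integrableD i2 i1.
  by apply: eq_integrable ih => // t /gh /= ->.
transitivity (\int[mu]_(t in `]0, +oo[) h t).
  by apply: eq_Rintegral => t /gh.
rewrite /h RintegralD// e1 big_cons; congr (_ + _).
rewrite RintegralZl//; last exact: integrable_powR_expR.
rewrite -mulrA; congr (_ * (_ * _)).
by rewrite /Gamma; congr Rintegral; apply/funext => t; congr (_ `^ _ * _); ring.
Qed.

(** The two divisions in [momentE] are moved to the coefficients, where [powsum_shift_ge0] preserves
    nonnegativity; what remains is the integral of a nonnegative function. *)
Lemma moment_pos_on_powers : pos_on_powers moment.
Proof.
move=> l hl h.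
pose l1 : seq (R * R) := [seq (p.1 / (p.2 + 2^-1), p.2) | p <- l].
pose l2 : seq (R * R) := [seq (p.1 / (p.2 + 1), p.2) | p <- l1].
have hl1 : {in l1, forall p : R * R, 0 <= p.2} by move=> _ /mapP[p /hl p0 ->].
have hl2 : {in l2, forall p : R * R, 0 <= p.2} by move=> _ /mapP[p /hl1 p0 ->].
have H t : 0 < t -> 0 <= powsum l2 t.
  apply: powsum_shift_ge0 => // {}t t0.
  apply: powsum_shift_ge0 => // {}t {}t0; exact/h/ltW.
have -> : \sum_(p <- l) p.1 * moment p.2 = 2 * dup_ratio (1 : R) *
    \sum_(p <- l2) p.1 * (2 `^ p.2 * Gamma (p.2 + 1 + 2^-1)).
  rewrite /l2 /l1 !big_map mulr_sumr; apply: eq_big_seq => p /hl p0 /=.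
  rewrite momentE//; move: (dup_ratio 1) (2 `^ _) (Gamma _) => a b c.
  by field; apply/andP; split; rewrite lt0r_neq0//; lra.
have d0 : 0 < dup_ratio (1 : R) by exact: dup_ratio_gt0.
apply: mulr_ge0; first by apply: mulr_ge0 => //; exact: ltW.
rewrite -(powsum_Gamma hl2).2; apply: Rintegral_ge0 => t /=.
rewrite in_itv/= andbT => t0; rewrite /g mulr_ge0 ?mulr_ge0 ?powR_ge0 ?expR_ge0//.
by apply: H; rewrite mulr_gt0.
Qed.

End moment.

(** * Approximation of moments of non-integral order *)

Lemma exp_series_le (R : realType) (x : R) n : 0 <= x ->
  \sum_(k < n) x ^+ k / k`!%:R <= expR x.
Proof.
move=> x0; rewrite -(big_mkord xpredT (fun k => x ^+ k / k`!%:R)).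
apply: nondecreasing_cvgn_le; last exact: is_cvg_series_exp_coeff.
by apply: nondecreasing_series => k _ _; exact: exp_coeff_ge0.
Qed.

Section moment_approximation.
Context {R : realType} {m : nat} {s : R}.
Hypothesis ms : m%:R < s < m%:R + 1.

(** This is [t^s] times the kernel at [tau t]; the factor turns the exponents into the integers
    [m + 1, ..., m + i], so that only integral moments enter. *)
Definition scaled_kernel (tau : R) (i : nat) : seq (R * R) :=
  [seq ((-1) ^+ j / (((m + j).+1%:R - s) * ((m + j).+1.*2)`!%:R) *
        tau `^ ((m + j).+1%:R - s), (m + j).+1%:R) | j <- iota 0 i].

Lemma scaled_kernel_sum tau i (f : R -> R) :
  \sum_(p <- scaled_kernel tau i) p.1 * f p.2 =
  \sum_(j < i) (-1) ^+ j / (((m + j).+1%:R - s) * ((m + j).+1.*2)`!%:R) *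
        tau `^ ((m + j).+1%:R - s) * f (m + j).+1%:R.
Proof. by rewrite big_map -[i in iota _ i]subn0 -/(index_iota 0 i) big_mkord. Qed.

Lemma scaled_kernelE tau i t : 0 < tau -> 0 < t ->
  powsum (scaled_kernel tau i) t = t `^ s * powsum (cos_kernel m s i) (tau * t).
Proof.
move=> tau0 t0; rewrite /powsum scaled_kernel_sum -/(powsum _ _).
rewrite powsum_cos_kernel mulr_sumr; apply: eq_bigr => j _.
have -> : t `^ (m + j).+1%:R = t `^ s * t `^ ((m + j).+1%:R - s).
  by rewrite -powRD ?(gt_eqF t0) ?implybT// addrC subrK.
rewrite powRM ?(ltW tau0) ?(ltW t0)//.
move: (_ / _) (tau `^ _) (t `^ s) (t `^ _) => a b c d; ring.
Qed.

Lemma s_gt0 : 0 < s.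
Proof. by case/andP: ms => + _; apply: le_lt_trans. Qed.

Lemma powsum_at0 (l : seq (R * R)) : {in l, forall p, p.2 != 0} -> powsum l 0 = 0.
Proof.
by move=> h; rewrite /powsum big_seq big1// => p /h p0; rewrite powR0// mulr0.
Qed.

Lemma scaled_kernel_at0 tau i : powsum (scaled_kernel tau i) 0 = 0.
Proof. by apply: powsum_at0 => _ /mapP[j _ ->] /=; rewrite pnatr_eq0. Qed.

(** Both [J] and [moment] are applied to the two inequalities [key]. The lower one costs
    [tau^(m-s)], the bound on [tau^N] controls the upper one, and the errors [D] are weighted by at
    most a constant times [tau^k / k!], whence [expR tau]. *)
Lemma moment_approx_nonint : exists C : R, forall J, pos_on_powers J -> J 0 <= 1 ->
  forall i N (tau D : R), odd i -> N = (m + i).+1 -> 1 <= tau ->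
    tau ^+ N <= 2 ^+ N * (N.+1)`!%:R -> 0 <= D ->
    (forall k, (0 < k <= N)%N -> `|J k%:R - moment k%:R| <= D) ->
  `|J s - moment s| <= C * (tau `^ (m%:R - s) + D * expR tau).
Proof.
have [c [c0 [C [C0 lim]]]] := cos_kernel_limit ms.
have s0 := s_gt0.
pose q := (m.+1%:R - s)^-1.
have q0' : 0 < m.+1%:R - s by rewrite subr_gt0 -natr1; case/andP: ms.
have q0 : 0 < q by rewrite invr_gt0.
pose Mm := moment (m%:R : R).
have Mm0 : 0 <= Mm by apply: moment_ge0.
exists ((C * (Mm + 2) + 2 * q) / c) => J Jpos J01 i N tau D oi NE tau1 tauN D0 JM.
have tau0 : 0 < tau by lra.
have N1 : m.+1%:R <= N%:R :> R by rewrite ler_nat NE ltnS leq_addr.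
have Ns : 0 < N%:R - s by lra.
pose u := tau `^ (N%:R - s) / ((N%:R - s) * (N.*2)`!%:R).
pose v := C * tau `^ (m%:R - s).
pose S (f : R -> R) := \sum_(p <- scaled_kernel tau i) p.1 * f p.2.
have fact0' k : 0 < k`!%:R :> R by rewrite ltr0n fact_gt0.
have u0 : 0 <= u by rewrite /u divr_ge0 ?powR_ge0// mulr_ge0// ltW.
have v0 : 0 <= v by rewrite mulr_ge0 ?powR_ge0.
have kpos : {in scaled_kernel tau i, forall p : R * R, 0 <= p.2}.
  by move=> _ /mapP[j _ ->] /=.
have key t : 0 <= t -> - (v * t `^ m%:R) <= powsum (scaled_kernel tau i) t - c * t `^ s <= u * t `^ N%:R.
  rewrite le_eqVlt => /predU1P[<-|t0].
    rewrite scaled_kernel_at0 !(powR0 (_ : N%:R != 0)) ?(powR0 (lt0r_neq0 s0)) ?mulr0 ?subr0 ?lexx ?andbT.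
      by rewrite oppr_le0 mulr_ge0 ?powR_ge0.
    by rewrite NE pnatr_eq0.
  have := lim i (tau * t) oi (mulr_gt0 tau0 t0).
  rewrite -(ler_pM2l (powR_gt0 s t0)) -(ler_pM2l (powR_gt0 s t0) (_ - _)) mulrBr.
  rewrite -scaled_kernelE// -NE [_ * c]mulrC.
  rewrite !powRM ?(ltW tau0) ?(ltW t0)//.
  have E k : t `^ k%:R = t `^ s * t `^ (k%:R - s).
    by rewrite -powRD ?(gt_eqF t0) ?implybT// addrC subrK.
  have -> : - (v * t `^ m%:R) =
      t `^ s * - (C * (tau `^ (m%:R - s) * t `^ (m%:R - s))) by rewrite E /v; ring.
  suff -> : u * t `^ N%:R = t `^ s * (tau `^ (N%:R - s) * t `^ (N%:R - s) /
      ((N%:R - s) * (N.*2)`!%:R)) by [].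
  by rewrite E /u; move: (_ * _)^-1 (t `^ _) (t `^ _) (tau `^ _) => ? ? ? ?; ring.
have posU L : pos_on_powers L -> 0 <= u * L N%:R + (c * L s - S L).
  move=> Lpos; have := Lpos ((u, N%:R) :: (c, s) :: powopp (scaled_kernel tau i)).
  rewrite !big_cons /= [X in _ + (_ + X)](_ : _ = - S L); last first.
    by rewrite big_map -sumrN; apply: eq_bigr => p _; rewrite mulNr.
  apply.
    move=> p; rewrite !inE => /or3P[/eqP->|/eqP->|/mapP[r /kpos r0 ->]]//=; exact: ltW s0.
  move=> t /key; rewrite !powsum_cons powsum_opp /=; lra.
have posL L : pos_on_powers L -> 0 <= v * L m%:R + (- c * L s + S L).
  move=> Lpos; have := Lpos ((v, m%:R) :: (- c, s) :: scaled_kernel tau i).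
  rewrite !big_cons /=; apply.
    move=> p; rewrite !inE => /or3P[/eqP->|/eqP->|/kpos]//=; exact: ltW s0.
  move=> t /key; rewrite !powsum_cons /=; lra.
have Mpos := @moment_pos_on_powers R.
have pows k : tau `^ (k%:R - s) = tau ^+ k * tau `^ (- s).
  by rewrite powRD ?(gt_eqF tau0) ?implybT// powR_mulrn// ltW.
pose E := tau `^ (m%:R - s).
have taus1 : tau `^ (- s) <= 1 by rewrite -(powRr0 tau) ler_powR//; lra.
have tausE : tau `^ (- s) <= E by rewrite /E ler_powR// -[leLHS]add0r lerD2r.
have E1 : E <= 1.
  by rewrite -(powRr0 tau) ler_powR//; case/andP: ms => /ltW; rewrite subr_le0.
have E0 : 0 <= E by exact: powR_ge0.
have qN : (N%:R - s)^-1 <= q by rewrite lef_pV2 ?posrE//; lra.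
have et1 : 1 <= expR tau by have := expR_ge1Dx tau; lra.
have De : D <= D * expR tau by rewrite ler_peMr.
have De0 : 0 <= D * expR tau by rewrite mulr_ge0 ?expR_ge0.
have termb k : tau ^+ k / k.*2`!%:R <= tau ^+ k / k`!%:R.
  rewrite ler_pM2l ?exprn_gt0// lef_pV2 ?posrE// ler_nat.
  by rewrite leq_fact// -addnn leq_addr.
(* The factor [(2N)!] cancels against the one in [moment N], leaving [tau^N / (2^N (N+1)!) <= 1]. *)
have uM : u * moment N%:R <= q * E.
  rewrite moment_natr /u pows.
  have -> : tau ^+ N * tau `^ (- s) / ((N%:R - s) * (N.*2)`!%:R) *
      ((N.*2)`!%:R / ((N.+1)`!%:R * 2 ^+ N)) =
      (N%:R - s)^-1 * (tau `^ (- s) * (tau ^+ N / (2 ^+ N * (N.+1)`!%:R))).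
    by field; rewrite !lt0r_neq0// exprn_gt0.
  apply: ler_pM => //; first by rewrite invr_ge0 ltW.
    by rewrite mulr_ge0 ?powR_ge0// divr_ge0 ?mulr_ge0 ?exprn_ge0// ltW.
  apply: le_trans tausE; rewrite ler_piMr ?powR_ge0//.
  by rewrite ler_pdivrMr ?mul1r// mulr_gt0// exprn_gt0.
have termq k n : (m < k <= n)%N ->
    tau `^ (k%:R - s) / ((k%:R - s) * (k.*2)`!%:R) <= q * (tau ^+ k / k`!%:R).
  move=> /andP[mk kn].
  have mk1 : m.+1%:R <= k%:R :> R by rewrite ler_nat.
  have k0 : 0 < k%:R - s by lra.
  have AC (a b c' d : R) : a * b * (c' * d) = c' * (b * (a * d)) by ring.
  rewrite pows invfM AC.
  apply: ler_pM; first by rewrite invr_ge0 ltW.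
  - by rewrite mulr_ge0 ?powR_ge0// divr_ge0 ?exprn_ge0// ltW.
  - by rewrite lef_pV2 ?posrE//; lra.
  - by apply: le_trans (termb k); rewrite ler_piMl// divr_ge0 ?exprn_ge0 ?(ltW tau0).
have uD : u * D <= q * (D * expR tau).
  rewrite mulrC [leRHS]mulrCA; apply: ler_wpM2l => //.
  apply: (@le_trans _ _ (q * (tau ^+ N / N`!%:R))).
    by apply: (termq N N); rewrite leqnn NE ltnS leq_addr.
  rewrite ler_pM2l//; apply: le_trans (exp_series_le N.+1 (ltW tau0)).
  rewrite big_ord_recr /= lerDr sumr_ge0// => k _.
  by rewrite divr_ge0 ?exprn_ge0 ?(ltW tau0).
have JMN : `|J N%:R - moment N%:R| <= D by apply: JM; rewrite NE leqnn.
have uJ : u * J N%:R <= q * E + q * (D * expR tau).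
  have : u * (J N%:R - moment N%:R) <= u * D.
    by rewrite ler_wpM2l// (le_trans (ler_norm _)).
  lra.
have Jm : J m%:R <= Mm + 1 + D.
  (* For [m = 0] the moment of order 0 is outside the range of [D]; there [J 0 <= 1] is used. *)
  case: m JM @Mm Mm0 NE {N1} => [|m'] JM Mm Mm0 NE; first lra.
  have : `|J m'.+1%:R - Mm| <= D.
    by apply: JM; rewrite NE /= ltnS ltnW// ltnS leq_addr.
  rewrite ler_norml; lra.
have vJ : v * J m%:R <= C * E * (Mm + 1) + C * (D * expR tau).
  have : v * J m%:R <= v * (Mm + 1 + D) by rewrite ler_wpM2l.
  have : C * E * D <= C * (D * expR tau).
    rewrite -mulrA ler_wpM2l//; apply: le_trans De.
    by rewrite ler_piMl.
  rewrite /v -/E; lra.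
have vM : v * moment m%:R = C * E * Mm by [].
have SD : `|S J - S moment| <= q * (D * expR tau).
  rewrite /S !scaled_kernel_sum -sumrB (le_trans (ler_norm_sum _ _ _))//.
  apply: (@le_trans _ _ (\sum_(j < i) q * D * (tau ^+ (m + j).+1 / ((m + j).+1)`!%:R))).
    apply: ler_sum => j _; rewrite -mulrBr !normrM normfV normrX normrN1 expr1n mul1r.
    have jN : ((m + j).+1 <= N)%N by rewrite NE ltnS leq_add2l ltnW.
    have jm : m.+1%:R <= (m + j).+1%:R :> R by rewrite ler_nat ltnS leq_addr.
    have jp : 0 < (m + j).+1%:R - s by lra.
    rewrite [`|_ * _`!%:R|]ger0_norm ?mulr_ge0 ?(ltW jp)//.
    rewrite (ger0_norm (powR_ge0 _ _)).
    have -> : q * D * (tau ^+ (m + j).+1 / ((m + j).+1)`!%:R) =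
      q * (tau ^+ (m + j).+1 / ((m + j).+1)`!%:R) * D by rewrite mulrAC.
    apply: ler_pM => //; last by apply: JM; rewrite jN.
      by rewrite mulr_ge0 ?powR_ge0// invr_ge0 mulr_ge0// ltW.
    rewrite mulrC; apply: (termq _ (m + j).+1).
    by rewrite leqnn andbT ltnS leq_addr.
  rewrite -mulr_sumr -mulrA ler_pM2l// ler_wpM2l//.
  apply: le_trans (exp_series_le (m.+1 + i) (ltW tau0)).
  rewrite big_split_ord /= lerDr sumr_ge0// => k _.
  by rewrite divr_ge0 ?exprn_ge0 ?(ltW tau0).
have h1 := posU _ Jpos; have h2 := posU _ Mpos.
have h3 := posL _ Jpos; have h4 := posL _ Mpos.
have p1 : 0 <= C * E by rewrite mulr_ge0.
have p2 : 0 <= C * (D * expR tau) by rewrite mulr_ge0.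
have p3 : 0 <= C * Mm * (D * expR tau) by apply: mulr_ge0 => //; exact: mulr_ge0.
have p4 : 0 <= q * E by rewrite mulr_ge0// ltW.
have p5 : 0 <= C * E * Mm by apply: mulr_ge0.
rewrite -/E [leRHS]mulrAC ler_pdivlMr// -[X in _ * X <= _](ger0_norm (ltW c0)) -normrM.
move: SD; rewrite !ler_norml => /andP[]; move: h1 h2 h3 h4 uM uJ vJ p1 p2 p3 p4 p5.
rewrite vM.
move: (u * J N%:R) (u * moment N%:R) (v * J m%:R) (S J) (S moment) (J s) (moment s).
move: (D * expR tau) => x uJ uM vJ SJ SM Js Ms *.
by apply/andP; split; lra.
Qed.

End moment_approximation.

(** For integral [s] the moment is itself among those compared and [theta = 1] is an arbitrary
    choice; otherwise [theta] is the fractional part of [s]. *)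
Lemma moment_approx (R : realType) (s : R) : 0 < s ->
  exists (C theta : R) (m : nat), [/\ 0 <= C, 0 < theta &
  forall J, pos_on_powers J -> J 0 <= 1 ->
  forall i N (tau D : R), odd i -> N = (m + i).+1 -> 1 <= tau ->
    tau ^+ N <= 2 ^+ N * (N.+1)`!%:R -> 0 <= D ->
    (forall k, (0 < k <= N)%N -> `|J k%:R - moment k%:R| <= D) ->
  `|J s - moment s| <= C * (tau `^ (- theta) + D * expR tau)].
Proof.
move=> s0; pose m := Num.truncn s.
have /andP[ms sm] : m%:R <= s < m.+1%:R by rewrite truncn_itv// ltW.
have [sE|sm'] := eqVneq s m%:R.
  exists 1, 1, m; split => // J _ _ i N tau D _ NE tau1 _ D0 JM.
  have m0 : (0 < m)%N by rewrite -(ltr0n R) -sE.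
  rewrite mul1r sE (@le_trans _ _ D)//.
    by apply: JM; rewrite m0 NE ltnW// ltnS leq_addr.
  rewrite ler_wpDl ?powR_ge0// ler_peMr// (le_trans _ (expR_ge1Dx tau))//; lra.
have ms' : m%:R < s < m%:R + 1.
  by rewrite natr1 sm andbT lt_neqAle eq_sym sm' ms.
have [C H] := moment_approx_nonint ms'.
exists `|C|, (s - m%:R), m; split => //; first by rewrite subr_gt0; case/andP: ms'.
move=> J Jpos J0 i N tau D oi NE tau1 tauN D0 JM.
apply: le_trans (H J Jpos J0 i N tau D oi NE tau1 tauN D0 JM) _.
rewrite opprB ler_wpM2r ?ler_norm// addr_ge0 ?powR_ge0// mulr_ge0 ?expR_ge0//.
Qed.

(** * Choice of the parameters and rate of convergence *)

Lemma expR1_le4 (R : realType) : expR (1 : R) <= 4.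
Proof.
have h : 2^-1 <= expR (- 2^-1 : R) by have := expR_ge1Dx (- 2^-1 : R); lra.
have -> : (1 : R) = 2^-1 + 2^-1 by lra.
have e0 := expR_gt0 (2^-1 : R).
have h2 : expR (2^-1 : R) <= 2.
  by rewrite -[leRHS]invrK -[leLHS]invrK lef_pV2 ?posrE ?invr_gt0// -expRN.
rewrite expRD; nra.
Qed.

Lemma expR1_ge2 (R : realType) : 2 <= expR (1 : R).
Proof. by have := expR_ge1Dx (1 : R); lra. Qed.

(** Makes [tau = N / 2] admissible in [moment_approx]; it follows from [N^N / N! <= e^N <= 4^N]. *)
Lemma half_exprn_le (R : realType) (N : nat) :
  (N%:R / 2) ^+ N <= 2 ^+ N * (N.+1)`!%:R :> R.
Proof.
have f0 : 0 < N`!%:R :> R by rewrite ltr0n fact_gt0.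
have h : N%:R ^+ N <= 4 ^+ N * N`!%:R :> R.
  rewrite -ler_pdivrMr//; apply: (@le_trans _ _ (expR N%:R)).
    apply: le_trans (exp_series_le N.+1 (ler0n R N)).
    by rewrite big_ord_recr /= lerDr sumr_ge0.
  rewrite -[X in expR X]mulr1 expRM_natl lerXn2r ?nnegrE ?expR_ge0//.
  exact: expR1_le4.
rewrite expr_div_n ler_pdivrMr ?exprn_gt0// mulrAC -exprMn.
have -> : 2 * 2 = 4 :> R by ring.
apply: (le_trans h); rewrite ler_pM2l ?exprn_gt0// ler_nat.
by rewrite leq_fact.
Qed.

(** With [a], [b] the logarithms of [A], [B], the left side is the logarithm of the error of the
    [N]-th moment times [expR tau]; a single exponential in [N] bounds it. *)
Lemma lnln_exponent_le (R : realType) (a b e : R) (N : nat) : 0 <= a -> 0 <= b -> 0 <= e ->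
  (0 < N)%N ->
  expR b ^+ N.*2 * a + N%:R * e <= expR ((2 * b + a + e + 1) * N%:R).
Proof.
move=> a0 b0 e0 N0.
have N1 : 1 <= N%:R :> R by rewrite ler1n.
set p := N%:R * (2 * b + a); set q := N%:R * e.
have p0 : 0 <= p by rewrite mulr_ge0//; lra.
have q0 : 0 <= q by rewrite mulr_ge0.
have h1 : expR b ^+ N.*2 * a <= expR p.
  rewrite -expRM_natl.
  have -> : p = N.*2%:R * b + N%:R * a by rewrite /p -mul2n natrM; ring.
  rewrite expRD ler_wpM2l ?expR_ge0// (@le_trans _ _ (N%:R * a))//.
    by rewrite ler_peMl.
  by have := expR_ge1Dx (N%:R * a); lra.
have h2 : q <= expR q by have := expR_ge1Dx q; lra.
have h3 : expR p <= expR (p + q) by rewrite ler_expR; lra.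
have h4 : expR q <= expR (p + q) by rewrite ler_expR; lra.
have -> : (2 * b + a + e + 1) * N%:R = N%:R + (p + q) by rewrite /p /q; ring.
apply: (@le_trans _ _ (expR 1 * expR (p + q))).
  have := ler_wpM2r (expR_ge0 (p + q)) (@expR1_ge2 R); lra.
by rewrite -expRD ler_expR; lra.
Qed.

Lemma level_bound (R : realType) (d l m L : R) :
  4 * d * l <= L -> 2 * d * m + 3 <= L -> d * (m + 2 * l) <= L - 1.
Proof. by move=> h1 h2; lra. Qed.

(** The factor [eps^(-k)] allows for the replacement of [ln X] by [ln (1 / delta)], which is at
    least [eps * ln X]. *)
Lemma moment_rate (R : realType) (s A B eps C0 : R) :
  0 < s -> 1 < A -> 1 < B -> 0 < eps <= 1 -> 0 <= C0 ->
  exists C, \forall X \near +oo, forall J, pos_on_powers J -> J 0 <= 1 ->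
    (forall k, (0 < k)%N ->
      `|J k%:R - moment k%:R| <= C0 * (A `^ (B ^+ k.*2) / eps ^+ k) / ln X) ->
    `|J s - moment s| <= C / iter_log 4 X.
Proof.
move=> s0 A1 B1 /andP[eps0 eps1] C00.
have [C [theta [m [C0' theta0 H]]]] := moment_approx s0.
have A0 : 0 < A by lra.
have B0 : 0 < B by lra.
have lnA : 0 <= ln A by rewrite ln_ge0// ltW.
have lnB : 0 <= ln B by rewrite ln_ge0// ltW.
have lne : 0 <= - ln eps by rewrite oppr_ge0 ln_le0.
pose D : R := 2 * ln B + ln A + (- ln eps + 2^-1) + 1.
have D0 : 0 < D by rewrite /D; lra.
have e0 : 0 <= - ln eps + 2^-1 by lra.
exists (C * ((4 * D) `^ theta / theta + 2 * C0)).
near=> X => J Jpos J01 JM.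
(* Room for the [m + 2] moments beyond [2 l] in the bound [D * N <= L3 - 1], and enough to make [L4]
   positive. *)
pose c : R := 2 * D * (m.+2%:R) + 3.
have c3 : 3 <= c by rewrite /c lerDr !mulr_ge0// ltW.
have Xc : expR (expR (expR c)) <= X.
  by near: X; apply: nbhs_pinfty_ge; exact: num_real.
have lnle x y : expR x <= y -> x <= ln y.
  by move=> xy; rewrite -(expRK x) ler_ln ?posrE ?expR_gt0// (lt_le_trans (expR_gt0 x)).
pose L1 := ln X; pose L2 := ln L1; pose L3 := ln L2; pose L4 := ln L3.
have -> : iter_log 4 X = L4 by [].
have hL1 : expR (expR c) <= L1 by exact: lnle.
have hL2 : expR c <= L2 by exact: lnle.
have hL3 : c <= L3 by exact: lnle.
have L10 : 0 < L1 by rewrite (lt_le_trans _ hL1)// expR_gt0.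
have L20 : 0 < L2 by rewrite (lt_le_trans _ hL2)// expR_gt0.
have L30 : 0 < L3 by lra.
have L40 : 0 < L4 by rewrite /L4 ln_gt0; lra.
have eL1 : expR L2 = L1 by rewrite /L2 lnK// posrE.
have eL2 : expR L3 = L2 by rewrite /L3 lnK// posrE.
(* The number of moments used is proportional to [log_3 X], so that their
   errors, of size exp (exp (D N)) / ln X, stay below (ln X)^(-1/2). *)
pose l := Num.truncn (L3 / (4 * D)).
have D40 : 0 < 4 * D by lra.
have /andP[l1 l2] : l%:R <= L3 / (4 * D) < l.+1%:R.
  by rewrite truncn_itv// divr_ge0// ltW.
pose i := (l.*2).+1.
have oi : odd i by rewrite /i /= odd_double.
pose N := (m + i).+1.
have N0 : (0 < N)%N by [].
have NR : N%:R = m.+2%:R + 2 * l%:R :> R.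
  by rewrite -natrM -natrD; congr (_%:R); rewrite /N /i mul2n addnS.
pose tau : R := N%:R / 2.
have m2 : 2 <= m.+2%:R :> R by rewrite ler_nat.
have tau_l : l.+1%:R <= tau.
  by rewrite /tau NR -(natr1 l); move: (l%:R : R) (m.+2%:R : R) m2 => ? ? ?; lra.
have tau1 : 1 <= tau by apply: le_trans tau_l; rewrite ler1n.
have tau_ge : L3 / (4 * D) <= tau by apply: le_trans tau_l; exact: ltW.
pose Dl := C0 * (A `^ (B ^+ N.*2) / eps ^+ N) / L1.
have Dl0 : 0 <= Dl.
  by rewrite /Dl divr_ge0 ?(ltW L10)// mulr_ge0// divr_ge0 ?powR_ge0 ?exprn_ge0 ?(ltW eps0).
have JD k : (0 < k <= N)%N -> `|J k%:R - moment k%:R| <= Dl.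
  move=> /andP[k0 kN]; apply: (le_trans (JM _ k0)).
  rewrite /Dl ler_pM2r ?invr_gt0// ler_wpM2l//.
  rewrite ler_pM ?powR_ge0 ?invr_ge0 ?exprn_ge0 ?(ltW eps0)//.
    rewrite ler_powR ?(ltW A1)// ler_eXn2l// ?leq_double//.
  by rewrite lef_pV2 ?posrE ?exprn_gt0// ler_wiXn2l// ltW.
apply: (le_trans (H J Jpos J01 i N tau Dl oi erefl tau1 (half_exprn_le R N) Dl0 JD)).
rewrite -[leRHS]mulrA; apply: ler_wpM2l => //; rewrite [leRHS]mulrDl; apply: lerD.
(* [tau^(-theta)] decays like a power of [log_3 X]; [theta * ln y <= y^theta] weakens this to a
   multiple of [1 / log_4 X]. *)
- have h1 : theta * L4 <= L3 `^ theta.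
    rewrite -ln_powR; apply: ltW; apply: ln_sublinear; exact: powR_gt0.
  rewrite powRN -mulrA -invfM.
  apply: (@le_trans _ _ ((L3 / (4 * D)) `^ theta)^-1).
    rewrite lef_pV2 ?posrE ?powR_gt0 ?divr_gt0 ?(lt_le_trans ltr01 tau1)//.
    by apply: powR_ler => //; [exact: ltW|rewrite divr_ge0// ltW].
  have -> : (L3 / (4 * D)) `^ theta = L3 `^ theta / (4 * D) `^ theta.
    apply: (canRL (mulfK _)); first by rewrite gt_eqF ?powR_gt0.
    by rewrite -powRM ?divfK ?gt_eqF// ?(ltW D40)// divr_ge0// ltW.
  rewrite invf_div ler_pM2l ?powR_gt0//.
  by rewrite lef_pV2 ?posrE ?mulr_gt0 ?powR_gt0.
- have -> : Dl * expR tau = C0 * (expR (expR (ln B) ^+ N.*2 * ln A +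
       N%:R * (- ln eps + 2^-1)) / L1).
    have eA k : A `^ k = expR (k * ln A) by rewrite /powR gt_eqF.
    have eE : (eps ^+ N)^-1 = expR (N%:R * - ln eps).
      by rewrite expRM_natl expRN lnK ?posrE// exprVn.
    have -> : expR (ln B) ^+ N.*2 * ln A + N%:R * (- ln eps + 2^-1) =
      B ^+ N.*2 * ln A + N%:R * - ln eps + tau by rewrite lnK ?posrE// mulrDr addrA.
    rewrite /Dl eA eE !expRD.
    by move: (expR _) (expR _) (expR _) L1^-1 => x y z w; ring.
  have -> : 2 * C0 / L4 = C0 * (2 / L4) by rewrite mulrCA mulrA.
  apply: (ler_wpM2l C00).
  have h1 := @lnln_exponent_le _ (ln A) (ln B) (- ln eps + 2^-1) N lnA lnB _ N0.
  have h2 : D * N%:R <= L3 - 1.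
    have : 4 * D * l%:R <= L3 by rewrite mulrC -ler_pdivlMr.
    by rewrite NR => hl; exact: level_bound.
  (* The 1 subtracted in [h2] becomes the factor 1/2, as [e >= 2]. Since [ln X = exp L2], the error
     is then at most [exp(- L2 / 2)]. *)
  have h3 : expR (D * N%:R) <= L2 / 2.
    apply: (@le_trans _ _ (expR (L3 - 1))); first by rewrite ler_expR.
    rewrite expRB eL2 ler_pM2l// lef_pV2 ?posrE ?expR_gt0//; exact: expR1_ge2.
  have h4 : expR (expR (ln B) ^+ N.*2 * ln A + N%:R * (- ln eps + 2^-1)) <= expR (L2 / 2).
    by rewrite ler_expR; apply: (le_trans _ h3); apply: h1; exact: e0.
  apply: (@le_trans _ _ (expR (L2 / 2) / L1)); first by rewrite ler_pM2r// invr_gt0.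
  have -> : L1 = expR (L2 / 2) * expR (L2 / 2) by rewrite -expRD -eL1 -splitr.
  rewrite invfM mulrA divff ?gt_eqF ?expR_gt0// mul1r.
  rewrite -[2 / L4]invf_div lef_pV2 ?posrE ?expR_gt0 ?divr_gt0//.
  apply: (@le_trans _ _ (L2 / 2)).
    rewrite ler_pM2r// (le_trans (ltW (ln_sublinear L30)))//.
    exact: ltW (ln_sublinear L20).
  by apply: le_trans (expR_ge1Dx (L2 / 2)); rewrite lerDr.
Unshelve. all: by end_near. Qed.

(** * The normalised gap of the Chebyshev function *)

Section psi_gap.
Context {R : realType}.
Notation mu := (@lebesgue_measure R).

Lemma vonMangoldt_ge0 n : 0 <= vonMangoldt R n.
Proof.
rewrite /vonMangoldt; case E : (primes n) => [//|p [|//]].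
have : p \in primes n by rewrite E mem_head.
by rewrite mem_primes => /andP[/prime_gt0 p0 _]; rewrite ln_ge0// ler1n.
Qed.

Lemma chebyshev_psi_nondecreasing : {homo @chebyshev_psi R : x y / x <= y}.
Proof.
move=> x y xy; rewrite /chebyshev_psi.
rewrite [leRHS](big_cat_nat (n := (Num.truncn x).+1))//=; last by rewrite ltnS le_truncn.
by rewrite lerDl sumr_ge0// => n _; exact: vonMangoldt_ge0.
Qed.

Lemma measurable_psi_gap delta (D : set R) : 0 <= delta ->
  measurable_fun D (psi_gap delta).
Proof.
move=> d0; apply: measurable_funS (_ : measurable_fun setT _) => //.
have mpsi : measurable_fun setT (@chebyshev_psi R).
  apply: nondecreasing_measurable => //; exact: chebyshev_psi_nondecreasing.
apply: measurable_funB; last exact: measurable_funM.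
apply: measurable_funB => //.
apply: nondecreasing_measurable => // x y xy.
by apply: chebyshev_psi_nondecreasing; rewrite lerD// ler_wpM2l.
Qed.

(** A crude bound, used for the integrability of the powers of the gap. *)
Lemma psi_gap_le delta (X x : R) : 0 <= delta -> 1 <= x <= X ->
  `|psi_gap delta x| <= 2 * chebyshev_psi (X + delta * X) + delta * X.
Proof.
move=> d0 /andP[x1 xX].
have x0 : 0 <= x by lra.
have psi0 y : 0 <= @chebyshev_psi R y.
  by rewrite /chebyshev_psi sumr_ge0// => n _; exact: vonMangoldt_ge0.
have dx : delta * x <= delta * X by rewrite ler_wpM2l.
have dx0 : 0 <= delta * x by rewrite mulr_ge0.
have h1 : chebyshev_psi (x + delta * x) <= chebyshev_psi (X + delta * X).
  by apply: chebyshev_psi_nondecreasing; rewrite lerD.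
have h2 : chebyshev_psi x <= chebyshev_psi (x + delta * x).
  by apply: chebyshev_psi_nondecreasing; rewrite lerDl.
have := psi0 x; rewrite /psi_gap ler_norml; lra.
Qed.

Lemma integrable_powR_bounded (h : R -> R) (X M e : R) : 0 <= e ->
  measurable_fun `[1, X] h -> (forall x, 1 <= x <= X -> 0 <= h x <= M) ->
  mu.-integrable `[1, X] (EFin \o (fun x => h x `^ e)).
Proof.
move=> e0 mh hM; apply: measurable_bounded_integrable => //.
- by rewrite /= lebesgue_measure_itv/=; case: ifP => _; rewrite ?ltry// -EFinB ltry.
- by apply: (measurableT_comp (f := @powR R ^~ e)) => //; exact: measurable_powR.
- exists (M `^ e); split; first exact: num_real.
  move=> y My x /=; rewrite in_itv/= => /hM /andP[h0 hxM].
  rewrite ger0_norm ?powR_ge0// (le_trans _ (ltW My))// powR_ler//.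
Qed.

(** Dividing by [X], not by the length [X - 1], matches the power of [X] in the main term; for
    [X > 1] the total mass is then just below 1. *)
Lemma mean_pos_on_powers (h : R -> R) (X M : R) : 0 <= X ->
  measurable_fun `[1, X] h -> (forall x, 1 <= x <= X -> 0 <= h x <= M) ->
  pos_on_powers (fun e => X^-1 * \int[mu]_(x in `[1, X]) (h x `^ e)).
Proof.
move=> X0 mh hM l hl hpos.
have [_ e1] : mu.-integrable `[1, X] (EFin \o (fun x => powsum l (h x))) /\
  \int[mu]_(x in `[1, X]) powsum l (h x) =
    \sum_(p <- l) p.1 * \int[mu]_(x in `[1, X]) (h x `^ p.2).
  elim: l hl {hpos} => [|p l IH] hl.
    have -> : (fun x => powsum [::] (h x)) = cst 0.
      by apply/funext => t; rewrite /powsum big_nil.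
    by split; [exact: integrable0|rewrite Rintegral_cst// mul0r big_nil].
  have p0 : 0 <= p.2 by apply: hl; rewrite mem_head.
  have [|i1 e1] := IH; first by move=> q ql; apply: hl; rewrite inE ql orbT.
  have i2 := integrable_powR_bounded p0 mh hM.
  have i3 : mu.-integrable `[1, X] (EFin \o (fun x => p.1 * h x `^ p.2)).
    exact: (integrableZl _ p.1 i2).
  have -> : (fun x => powsum (p :: l) (h x)) =
      (fun x => p.1 * h x `^ p.2 + powsum l (h x)).
    by apply/funext => x; rewrite powsum_cons.
  split; first exact: integrableD i3 i1.
  by rewrite RintegralD// e1 big_cons RintegralZl.
rewrite [leRHS](_ : _ = X^-1 * \int[mu]_(x in `[1, X]) powsum l (h x)).
  rewrite mulr_ge0 ?invr_ge0//; apply: Rintegral_ge0 => x /=.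
  by rewrite in_itv/= => /hM /andP[h0 _]; exact: hpos.
by rewrite e1 mulr_sumr; apply: eq_bigr => p _; rewrite mulrCA.
Qed.

Lemma powR_scale (X delta L s : R) : 0 < X -> 0 <= delta -> 0 <= L ->
  X * (X * delta * L) `^ s = X `^ (s + 1) * delta `^ s * L `^ s.
Proof.
move=> X0 d0 L0; rewrite !powRM ?mulr_ge0 ?(ltW X0)//.
by rewrite powRD ?(gt_eqF X0) ?implybT// powRr1 ?(ltW X0)//; ring.
Qed.

End psi_gap.

Theorem theorem2 (R : realType) (eps : R) (heps : 0 < eps)
  (hmoments : exists A B : R, 1 < A /\ 1 < B /\
     exists C : R, \forall X \near +oo,
       forall (k : nat) (delta : R), (0 < k)%N -> ~~ odd k ->
         X `^ (-1 + eps) <= delta <= X `^ (- eps) ->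
         `| \int[@lebesgue_measure R]_(x in `[1, X]) (psi_gap delta x ^+ k)
            - Gamma (k%:R + 1) / (Gamma (k%:R / 2 + 2) * 2 `^ (k%:R / 2))
              * X `^ (k%:R / 2 + 1) * delta `^ (k%:R / 2)
              * (ln (1 / delta)) `^ (k%:R / 2) |
         <= C * (A `^ (B ^+ k) * X `^ (k%:R / 2 + 1) * delta `^ (k%:R / 2)
                 * (ln X) `^ (k%:R / 2 - 1))) :
  forall lam : R, 0 < lam ->
    exists C : R, \forall X \near +oo,
      forall delta : R,
        X `^ (-1 + eps) <= delta <= X `^ (- eps) ->
        `| \int[@lebesgue_measure R]_(x in `[1, X]) (`|psi_gap delta x| `^ lam)
           - Gamma (lam + 1) / (Gamma (lam / 2 + 2) * 2 `^ (lam / 2))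
             * X `^ (lam / 2 + 1) * delta `^ (lam / 2)
             * (ln (1 / delta)) `^ (lam / 2) |
        <= C * (X `^ (lam / 2 + 1) * delta `^ (lam / 2)
                * (ln (1 / delta)) `^ (lam / 2) / iter_log 4 X).
Proof.
have [A [B [A1 [B1 [C0 hm]]]]] := hmoments.
move=> lam lam0.
(* For [eps > 1] the range of [delta] is empty once [X > 1]. With [eps <= 1] the factor [eps^(-k)]
   is nondecreasing in [k], as [moment_rate] requires. *)
have [eps1|eps1] := leP eps 1; last first.
  exists 0; near=> X => delta /andP[d1 d2]; exfalso.
  have X1 : 1 < X by near: X; apply: nbhs_pinfty_gt; exact: num_real.
  have lnX : 0 < ln X by rewrite ln_gt0.
  have Xpow e : X `^ e = expR (e * ln X) by rewrite /powR gt_eqF//; lra.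
  have := le_trans d1 d2; rewrite !Xpow ler_expR ler_pM2r//; lra.
have s0 : 0 < lam / 2 by rewrite divr_gt0.
have e01 : 0 < eps <= 1 by rewrite heps.
have [C hC] := moment_rate s0 A1 B1 e01 (normr_ge0 C0).
exists C; apply: filter_app hC; apply: filter_app hm.
near=> X => hm hC delta dX; have /andP[d1 d2] := dX.
have X1 : 1 < X by near: X; apply: nbhs_pinfty_gt; exact: num_real.
have X0 : 0 < X by lra.
have lnX : 0 < ln X by rewrite ln_gt0.
have d0 : 0 < delta by rewrite (lt_le_trans _ d1)// powR_gt0.
pose L := ln (1 / delta).
have Leps : eps * ln X <= L.
  rewrite /L div1r lnV ?posrE// lerNr -mulNr -ln_powR ler_ln ?posrE//.
  exact: powR_gt0.
have L0 : 0 < L by rewrite (lt_le_trans _ Leps)// mulr_gt0.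
pose S := X * delta * L.
have S0 : 0 < S by rewrite !mulr_gt0.
(* Squaring turns the even orders [2 k] of the hypothesis into all positive orders [k] for [h]. *)
pose h x := `|psi_gap delta x| ^+ 2 / S.
have h0 x : 0 <= h x by rewrite divr_ge0 ?exprn_ge0// ltW.
have hpow x e : `|psi_gap delta x| `^ (2 * e) = S `^ e * h x `^ e.
  rewrite -powRM ?(ltW S0)// powRrM powR_mulrn//; congr (_ `^ _).
  by rewrite /h mulrC divfK ?gt_eqF.
pose M0 := 2 * chebyshev_psi (X + delta * X) + delta * X.
have mh : measurable_fun `[1, X] h.
  apply: measurable_funM => //; apply: measurable_funX.
  by apply: measurableT_comp => //; apply: measurable_psi_gap; exact: ltW.
have hM x : 1 <= x <= X -> 0 <= h x <= M0 ^+ 2 / S.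
  move=> x1X; rewrite h0/= ler_pM2r ?invr_gt0// lerXn2r ?nnegrE//.
    by rewrite (le_trans _ (psi_gap_le (ltW d0) x1X)).
  exact: psi_gap_le (ltW d0) x1X.
pose J e := X^-1 * \int[@lebesgue_measure R]_(x in `[1, X]) (h x `^ e).
have Jpos : pos_on_powers J by exact: mean_pos_on_powers (ltW X0) mh hM.
have J0 : J 0 <= 1.
  rewrite /J; under eq_Rintegral do rewrite powRr0.
  rewrite Rintegral_cst//= lebesgue_measure_itv/= lte_fin X1 -EFinB/= mul1r.
  by rewrite ler_pdivrMl// mulr1 gerBl.
have intE e : 0 <= e -> \int[@lebesgue_measure R]_(x in `[1, X]) (`|psi_gap delta x| `^ (2 * e)) =
    X * S `^ e * J e.
  move=> e0; rewrite /J [RHS]mulrACA divff ?gt_eqF// mul1r.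
  under eq_Rintegral do rewrite hpow.
  by rewrite RintegralZl//; exact: integrable_powR_bounded hM.
have mainE e : 0 <= e -> Gamma (2 * e + 1) / (Gamma (e + 2) * 2 `^ e) *
    X `^ (e + 1) * delta `^ e * L `^ e = X * S `^ e * moment e.
  move=> e0; rewrite powR_scale ?(ltW d0) ?(ltW L0)// /moment.
  by move: (_ / _) (X `^ _) (delta `^ _) (L `^ _) => a b c d; ring.
have hJ k : (0 < k)%N ->
    `|J k%:R - moment k%:R| <= `|C0| * (A `^ (B ^+ k.*2) / eps ^+ k) / ln X.
  move=> k0.
  have k2 : k.*2%:R / 2 = k%:R :> R by rewrite -mul2n natrM mulrC mulKf.
  have intk : \int[@lebesgue_measure R]_(x in `[1, X]) (psi_gap delta x ^+ k.*2) =
      X * S `^ k%:R * J k%:R.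
    rewrite -intE//; apply: eq_Rintegral => x _.
    by rewrite -natrM mul2n powR_mulrn// -!mul2n !exprM real_normK ?num_real.
  have := hm k.*2 delta; rewrite double_gt0 odd_double => /(_ k0 isT dX).
  rewrite k2 intk -/L.
  have -> : k.*2%:R = 2 * k%:R :> R by rewrite -mul2n natrM.
  rewrite mainE// -mulrBr normrM ger0_norm; last by rewrite mulr_ge0 ?powR_ge0 ?ltW.
  move=> hk.
  rewrite -(ler_pM2l (mulr_gt0 X0 (powR_gt0 k%:R S0))); apply: (le_trans hk).
  apply: (@le_trans _ _ (`|C0| * (A `^ (B ^+ k.*2) * X `^ (k%:R + 1) *
      delta `^ k%:R * ln X `^ (k%:R - 1)))).
    by rewrite ler_wpM2r ?ler_norm// !mulr_ge0 ?powR_ge0.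
  have -> : X * S `^ k%:R * (`|C0| * (A `^ (B ^+ k.*2) / eps ^+ k) / ln X) =
      `|C0| * (A `^ (B ^+ k.*2) * X `^ (k%:R + 1) * delta `^ k%:R *
        (L `^ k%:R / (eps ^+ k * ln X))).
    rewrite powR_scale ?(ltW d0) ?(ltW L0)//.
    rewrite invfM.
    by move: (eps ^+ k)^-1 (X `^ _) (delta `^ _) (L `^ _) (A `^ _) (ln X)^-1 => *; ring.
  rewrite ler_wpM2l// ler_wpM2l ?mulr_ge0 ?powR_ge0//.
  (* One factor [1 / ln X] is split off as the saving; [eps * ln X <= L] then turns [(ln X)^k] into
     [L^k / eps^k]. *)
  rewrite powRB ?(gt_eqF lnX) ?implybT// powRr1 ?(ltW lnX)// invfM mulrA.
  rewrite ler_pM2r ?invr_gt0// ler_pdivlMr ?exprn_gt0//.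
  rewrite !powR_mulrn ?(ltW lnX) ?(ltW L0)// -exprMn lerXn2r ?nnegrE ?(ltW L0)//.
    by rewrite mulr_ge0 ?ltW.
  by rewrite mulrC.
have lamE : 2 * (lam / 2) = lam by rewrite mulrC divfK.
have := intE _ (ltW s0); have := mainE _ (ltW s0); rewrite lamE => -> ->.
rewrite -mulrBr normrM ger0_norm; last by rewrite mulr_ge0 ?powR_ge0 ?ltW.
rewrite -powR_scale ?(ltW d0) ?(ltW L0)// -/S.
apply: (le_trans (ler_wpM2l _ (hC J Jpos J0 hJ))).
  by rewrite mulr_ge0 ?powR_ge0 ?ltW.
by rewrite mulrCA mulrA.
Unshelve. all: by end_near. Qed.
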